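(* Every attainable $3\times 3$ row-stochastic matrix $P$ is expressible as a product of at most seven elementary row-stochastic ($3\times3$) matrices.
   Context: A row-stochastic matrix is a real matrix with nonnegative entries whose rows each sum to $1$. A non-homogeneous continuous-time Markov process with $3$ states is a continuous map $(s,t)\mapsto P(s,t)$, defined for $0\le s\le t<\infty$, where each $P(s,t)$ is a $3\times 3$ row-stochastic matrix, such that $P(s,s)=I$ for all $s\ge 0$ and $P(r,s)P(s,t)=P(r,t)$ for all $0\le r\le s\le t$. A $3\times 3$ row-stochastic matrix $P$ is called attainable (or embeddable) if $P=P(0,1)$ for some such process $P(\cdot,\cdot)$. For indices $1\le i,j\le 3$ with $i\ne j$ and $0\le t<1$, put $K_{ij}(t)=I+t(E_{ij}-E_{ii})$, where $E_{ij}$ are the matrix units. These matrices are called elementary row-stochastic matrices. *)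

(* Defs.v *)
From HB Require Import structures.
From mathcomp Require Import all_boot all_order all_algebra.
From mathcomp Require Import all_classical all_reals topology normedtype.

Set Implicit Arguments.
Unset Strict Implicit.
Unset Printing Implicit Defensive.

Import Order.TTheory GRing.Theory Num.Theory.
Import numFieldNormedType.Exports.

Local Open Scope classical_set_scope.
Local Open Scope ring_scope.

Definition row_stochastic (R : realType) (n : nat) (A : 'M[R]_n) : Prop :=
  (forall i j, 0 <= A i j) /\ (forall i, \sum_(j < n) A i j = 1).

Definition time_domain (R : realType) : set (R * R) :=
  [set st | 0 <= st.1 <= st.2].

(* The process is a total function of (s, t); only its values on time_domain
   are constrained, and continuity is joint continuity for the subspace
   topology of time_domain. *)
Record markov_process (R : realType) (n : nat) (P : R -> R -> 'M[R]_n) : Prop :=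
  MarkovProcess {
    markov_continuous :
      {within @time_domain R, continuous (fun st : R * R => P st.1 st.2)};
    markov_stochastic : forall s t, 0 <= s <= t -> row_stochastic (P s t);
    markov_id : forall s, 0 <= s -> P s s = 1%:M;
    markov_comp : forall r s t, 0 <= r -> r <= s -> s <= t ->
      P r s *m P s t = P r t
  }.

Definition attainable (R : realType) (n : nat) (A : 'M[R]_n) : Prop :=
  row_stochastic A /\
  exists P : R -> R -> 'M[R]_n, markov_process P /\ A = P 0 1.

Definition elementary_mx (R : realType) (n : nat) (i j : 'I_n) (t : R) :
  'M[R]_n := 1%:M + t *: (delta_mx i j - delta_mx i i).

Definition is_elementary (R : realType) (n : nat) (A : 'M[R]_n) : Prop :=
  exists (i j : 'I_n) (t : R),
    [/\ i != j, 0 <= t, t < 1 & A = elementary_mx i j t].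

(* Main.v *)
From mathcomp Require Import all_boot all_order all_algebra.
From mathcomp Require Import all_classical all_reals topology normedtype derive.
From mathcomp Require Import ring lra.
Require Import Defs.

Import Order.TTheory GRing.Theory Num.Theory.
Import numFieldNormedType.Exports.

Local Open Scope ring_scope.

Set Implicit Arguments.
Unset Strict Implicit.
Unset Printing Implicit Defensive.

(** Why seven elementary matrices suffice.

    Read the rows of a stochastic matrix as the vertices of a triangle.  Multiplying on the
    left by K_xy moves vertex x towards vertex y, so up to positive scaling of the rows it adds
    t times row y to row x; write E_xy(t) for this addition.  A product of elementary matrices
    is, up to row scaling, obtained from a diagonal matrix by as many row additions, and row
    additions preserve the determinant.

    The central notion is a condition on the cofactors C_ij, for distinct i, j, l:
      C_ij <= 0   and   (C_il <= 0  or  det M * M_ji <= - C_ij M_ii M_jj)      [admissible].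
    It means that row j can be subtracted from row l until an off-diagonal entry vanishes while
    the necessary inequality det <= M_ii M_jj M_ll persists.  A matrix with an off-diagonal
    zero and this inequality is an explicit product of five additions (zero_entry_rowgen), so
    an admissible matrix costs six.

    Row additions preserve admissibility, possibly for another index pair, with one exception:
    E_ji may leave the condition for (i, j) (admissible_addrow).  Let reach1 be the matrices
    E_ji(s) Q and reach2 the matrices E_il(u) E_ji(s) Q with Q admissible for (i, j).  The
    commutation rules of row additions show that every addition sends reach2 to itself, except
    that E_lj(w) E_il(u) E_ji(s) Q needs an argument of its own (reach2_addrow_next).  There,
    suppose that M is such a matrix outside reach2.  All the ways of writing M in this form
    make up a compact set of parameters (w, u, s), and none of them lies on the boundary of the
    conditions, since there M would be in reach2.  So the function - C_ij Q_ii Q_jj / Q_ji,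
    which is at least det M on this set, has an interior local maximum.  The first-order
    conditions give u and s in terms of Q, and leave three parameters c, f, k for Q up to
    scaling; the second-order conditions give f + f^2 + 1 <= f^2 c (crit_second).  But under
    this inequality subtracting part of row l from row j of E_il(u) E_ji(s) Q gives a matrix
    that is admissible for (l, j) (escape), and this puts M in reach2: a contradiction.

    Finally a matrix in reach2 costs seven additions, not eight: on the way from Q to
    E_ji(s) Q, either the last matrix is still admissible, or the path passes through one
    where the inequality is an equality, and such a matrix costs only five (reach1_rowgen).

    An attainable matrix is a limit of products of elementary matrices: cut [0, 1] into pieces
    on which the process is near the identity and replace each factor by a product of six
    elementary matrices.  The error is quadratic in the defect of the factor, and the defects
    have a bounded sum because the determinants multiply to det P(0, 1) > 0.  The determinants
    of the approximations stay away from 0, which keeps the parameters of the seven-letter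
    words in a compact subset of [0, 1); a limit of such words is again one. *)

(** * Triples of distinct indices *)

Section Frames.

(** Stating everything for an arbitrary triple of distinct indices covers all relabellings of
    the three states at once. *)
Definition frame (i j l : 'I_3) : bool := [&& i != j, j != l & i != l].

Lemma frame23 i j l : frame i j l -> frame i l j.
Proof. by rewrite /frame (eq_sym j) => /and3P[-> -> ->]. Qed.

Lemma frame_ex i j : i != j -> exists l, frame i j l.
Proof.
move=> ij; have [l] : exists l, (l != i) && (l != j).
  case: i j ij => [[|[|[|//]]] ?] [[|[|[|//]]] ?] // _.
  - by exists ord_max.
  - by exists (lift ord0 ord0).
  - by exists ord_max.
  - by exists ord0.
  - by exists (lift ord0 ord0).
  - by exists ord0.
by move=> /andP[li lj]; exists l; rewrite /frame ij ![_ == l]eq_sym li lj.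
Qed.

Lemma frame_ind i j l (F : frame i j l) (P : 'I_3 -> Prop) :
  P i -> P j -> P l -> forall a, P a.
Proof.
case/and3P: F => ij jl il Pi Pj Pl a.
have [->//|ai] := eqVneq a i; have [->//|aj] := eqVneq a j.
have [->//|al] := eqVneq a l; exfalso.
move: ij jl il ai aj al; rewrite -!val_eqE /=.
by case: i j l a {Pi Pj Pl} => [[|[|[|//]]] ?] [[|[|[|//]]] ?] [[|[|[|//]]] ?] [[|[|[|//]]] ?].
Qed.

Lemma frame_ind2 i j l (F : frame i j l) (P : 'I_3 -> 'I_3 -> Prop) :
  P i j -> P j i -> P i l -> P l i -> P j l -> P l j ->
  forall x y, x != y -> P x y.
Proof.
move=> Pij Pji Pil Pli Pjl Plj x y; elim/(frame_ind F): x.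
- by elim/(frame_ind F): y; rewrite ?eqxx.
- by elim/(frame_ind F): y; rewrite ?eqxx.
- by elim/(frame_ind F): y; rewrite ?eqxx.
Qed.

Lemma frame_neq i j l : frame i j l ->
  (i != j) * (j != i) * (i != l) * (l != i) * (j != l) * (l != j).
Proof.
by move=> /and3P[ij jl il]; rewrite (eq_sym j i) (eq_sym l i) (eq_sym l j) ij jl il.
Qed.

Lemma sum_frame (R : nmodType) i j l (f : 'I_3 -> R) :
  frame i j l -> \sum_c f c = f i + f j + f l.
Proof.
move=> F; have /and3P[ij jl il] := F.
rewrite (bigD1 i) //= (bigD1 j) /= 1?eq_sym // (bigD1 l) /= ?(eq_sym l) ?il ?jl //.
rewrite big1 ?addr0 ?addrA // => c.
by elim/(frame_ind F): c; rewrite !eqxx ?andbF.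
Qed.

End Frames.

(** * Row additions and the cofactor condition *)

Section RowOps.
Variable R : realType.
Implicit Types (M N Q Z : 'M[R]_3) (i j l x y : 'I_3) (s t u : R).

Lemma det_frame M i j l : frame i j l ->
  \det M = M i i * M j j * M l l + M i j * M j l * M l i + M i l * M l j * M j i
    - M i i * M j l * M l j - M j j * M i l * M l i - M l l * M i j * M j i.
Proof.
have E : \det M = M ord0 ord0 * (M (lift ord0 ord0) (lift ord0 ord0) * M ord_max ord_max
      - M (lift ord0 ord0) ord_max * M ord_max (lift ord0 ord0))
    - M ord0 (lift ord0 ord0) * (M (lift ord0 ord0) ord0 * M ord_max ord_max
      - M (lift ord0 ord0) ord_max * M ord_max ord0)
    + M ord0 ord_max * (M (lift ord0 ord0) ord0 * M ord_max (lift ord0 ord0)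
      - M (lift ord0 ord0) (lift ord0 ord0) * M ord_max ord0).
  rewrite (expand_det_row _ ord0) !big_ord_recl big_ord0.
  rewrite /cofactor !(expand_det_row _ ord0) !big_ord_recl !big_ord0 /cofactor !det_mx11 !mxE
    /=.
  have -> : lift (lift ord0 (lift ord0 ord0)) ord0 = ord0 :> 'I_3 by exact: val_inj.
  have -> : lift (lift ord0 (lift ord0 ord0)) (lift ord0 ord0) = lift ord0 ord0 :> 'I_3
    by exact: val_inj.
  have -> : lift (lift ord0 ord0) (lift ord0 ord0) = ord_max :> 'I_3 by exact: val_inj.
  have -> : lift (lift ord0 ord0) ord0 = ord0 :> 'I_3 by exact: val_inj.
  have -> : lift ord0 (lift ord0 ord0) = ord_max :> 'I_3 by exact: val_inj.
  have -> : lift ord0 (lift (lift ord0 ord0) 0) = lift ord0 ord0 :> 'I_3 by exact: val_inj.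
  have -> : lift (lift ord0 ord0) (lift (lift ord0 ord0) 0) = ord0 :> 'I_3 by exact: val_inj.
  have -> : lift ord_max (lift (lift ord0 ord0) 0) = ord0 :> 'I_3 by exact: val_inj.
  by rewrite /bump /= !(expr0, expr1, exprS, addn0, add0n); ring.
move=> F; rewrite {}E.
have F0 : frame ord0 (lift ord0 ord0) ord_max by [].
move: F; elim/(frame_ind F0): i; elim/(frame_ind F0): j; elim/(frame_ind F0): l;
 rewrite /frame ?eqxx ?andbF //= => _; ring.
Qed.

(** Unlike the elementary stochastic matrices, row additions keep the determinant and satisfy
    exact commutation rules; row sums are normalized again in rowgen_prod. *)
Definition addrow x y t M : 'M[R]_3 :=
  \matrix_(a, b) (if a == x then M x b + t * M y b else M a b).

Lemma addrowx x y t M b : addrow x y t M x b = M x b + t * M y b.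
Proof. by rewrite mxE eqxx. Qed.

Lemma addrown x y t M a b : a != x -> addrow x y t M a b = M a b.
Proof. by rewrite mxE => /negbTE ->. Qed.

Lemma det_addrow x y t M : x != y -> \det (addrow x y t M) = \det M.
Proof.
move=> xy; have [l F] := frame_ex xy; have /and3P[_ yl xl] := F.
rewrite !(det_frame _ F) !addrowx !addrown ?(eq_sym y) ?(eq_sym l) //; ring.
Qed.

Definition scale (d : 'I_3 -> R) M : 'M[R]_3 := \matrix_(a, b) (d a * M a b).

Lemma det_scale d M i j l : frame i j l -> \det (scale d M) = d i * d j * d l * \det M.
Proof. by move=> F; rewrite !(det_frame _ F) !mxE; ring. Qed.

Definition pos_mx M := (forall a b, 0 <= M a b) /\ 0 < \det M.

Lemma pos_addrow x y t M : x != y -> 0 <= t -> pos_mx M -> pos_mx (addrow x y t M).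
Proof.
move=> xy t0 [M0 dM]; split; last by rewrite det_addrow.
move=> a b; rewrite mxE; case: ifP => _; last exact: M0.
by rewrite addr_ge0 ?mulr_ge0.
Qed.

Lemma pos_scale d M : (forall a, 0 < d a) -> pos_mx M -> pos_mx (scale d M).
Proof.
move=> d0 [M0 dM]; split.
  by move=> a b; rewrite mxE mulr_ge0 ?(ltW (d0 _)).
have F0 : frame ord0 (lift ord0 ord0) ord_max by [].
by rewrite (det_scale _ _ F0) !mulr_gt0.
Qed.

(** Naming the third index l gives the off-diagonal cofactor (i, j) by one expression, sign
    included, for every triple. *)
Definition cofac i j l M := M j l * M l i - M j i * M l l.

(** The two alternatives correspond to which entry of row l vanishes first when a multiple of
    row j is subtracted from it: entry j if C_il <= 0, entry i otherwise.  See
    admissible_rowgen. *)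
Definition admissible i j l M :=
  cofac i j l M <= 0 /\ (cofac i l j M <= 0 \/ \det M * M j i
    <= - cofac i j l M * M i i * M j j).

Definition admissible_any M := exists i j l, frame i j l /\ admissible i j l M.

(** Jacobi's identity for the complementary minors of the adjugate: it trades the determinant
    in the condition for a product of two cofactors, so that only their signs matter when
    they differ. *)
Lemma edet_id M i j l : frame i j l ->
  - cofac i j l M * M i i * M j j - \det M * M j i
  = - cofac i j l M * M i j * M j i - cofac i l j M * cofac l j i M.
Proof. by move=> F; rewrite (det_frame _ F) /cofac; ring. Qed.

Lemma edet_of_prod M i j l : frame i j l -> pos_mx M -> cofac i j l M <= 0 ->
  cofac i l j M * cofac l j i M <= 0 -> \det M * M j i <= - cofac i j l M * M i i * M j j.
Proof.
move=> F [M0 _] c1 c2; rewrite -subr_ge0 edet_id // subr_ge0 (le_trans c2)//.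
by rewrite !mulr_ge0// oppr_ge0.
Qed.

(** The roles of C_il and C_lj can be exchanged, because by edet_id the determinant inequality
    follows when they have opposite signs. *)
Lemma admissible_sym M i j l : frame i j l -> pos_mx M -> cofac i j l M <= 0 ->
  cofac l j i M <= 0 -> admissible i j l M.
Proof.
move=> F pM c1 c2; split=> //; case: (lerP (cofac i l j M) 0) => c3; [by left|right].
by apply: edet_of_prod => //; rewrite mulr_ge0_le0 // ltW.
Qed.

Lemma admissible_edet M i j l : frame i j l -> pos_mx M -> admissible i j l M ->
  0 <= cofac l j i M ->
  \det M * M j i <= - cofac i j l M * M i i * M j j.
Proof.
move=> F pM [c1 [c2|//]] c3; apply: edet_of_prod => //.
by rewrite mulr_le0_ge0.
Qed.

(** The inequality det <= product of the diagonal holds for every product of elementary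
    matrices; for a matrix with an off-diagonal zero it will also be sufficient. *)
Lemma admissible_goodman M i j l : frame i j l -> pos_mx M -> admissible i j l M ->
  \det M <= M i i * M j j * M l l.
Proof.
move=> F [M0 dM] [c1 [c2|]].
  rewrite -subr_ge0; suff -> : M i i * M j j * M l l - \det M
    = M i l * (- cofac i l j M) + M i j * (- cofac i j l M) + M j l * M l j * M i i.
    by rewrite !addr_ge0 ?mulr_ge0 ?oppr_ge0.
  by rewrite (det_frame _ F) /cofac; ring.
have [z|p] := eqVneq (M j i) 0; last first.
  have {}p : 0 < M j i by rewrite lt_neqAle eq_sym p /=.
  move=> E; rewrite -(ler_pM2r p) (le_trans E)// -mulrA.
  have -> : M i i * M j j * M l l * M j i = (M j i * M l l) * (M i i * M j j) by ring.
  rewrite ler_wpM2r ?mulr_ge0 // /cofac opprB lerBlDr lerDl mulr_ge0 //.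
move=> _; move: c1; rewrite /cofac z mul0r subr0 => c1.
have {c1}z2 : M j l * M l i = 0 by apply/le_anti; rewrite c1 mulr_ge0.
rewrite -subr_ge0; suff -> : M i i * M j j * M l l - \det M
    = M i i * M j l * M l j + M j j * M i l * M l i - M i j * (M j l * M l i).
  by rewrite z2 mulr0 subr0 addr_ge0 ?mulr_ge0.
by rewrite (det_frame _ F) z; ring.
Qed.

Lemma diag_gt0 M i j l : pos_mx M -> \det M <= M i i * M j j * M l l ->
  [/\ 0 < M i i, 0 < M j j & 0 < M l l].
Proof.
move=> [M0 dM] g; have := lt_le_trans dM g.
have e a : 0 < M a a = (M a a != 0) by rewrite lt_neqAle eq_sym M0 andbT.
rewrite !e; do !case: eqP => [->|_]; rewrite ?mulr0 ?mul0r ?ltxx //.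
Qed.

End RowOps.

(** * How row additions act on the cofactor condition *)

Section Monotone.
Variable R : realType.
Implicit Types (M N Q Z : 'M[R]_3) (i j l x y : 'I_3) (s t u : R).

Lemma cofac_rowi t M i j l y : frame i j l -> cofac i j l (addrow i y t M) = cofac i j l M.
Proof. by move=> F; rewrite /cofac !addrown ?(frame_neq F). Qed.

Lemma cofac_add_jl t M i j l : frame i j l -> cofac i j l (addrow j l t M) = cofac i j l M.
Proof. by move=> F; rewrite /cofac !(addrowx, addrown) ?(frame_neq F) //; ring. Qed.

Lemma cofac_add_lj t M i j l : frame i j l -> cofac i j l (addrow l j t M) = cofac i j l M.
Proof. by move=> F; rewrite /cofac !(addrowx, addrown) ?(frame_neq F) //; ring. Qed.

Lemma cofac_add_li t M i j l : frame i j l ->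
  cofac i j l (addrow l i t M) = cofac i j l M - t * cofac l j i M.
Proof. by move=> F; rewrite /cofac !(addrowx, addrown) ?(frame_neq F) //; ring. Qed.

Lemma admissible_scale d M i j l : frame i j l -> (forall a, 0 < d a) ->
  admissible i j l M -> admissible i j l (scale d M).
Proof.
move=> F d0; have djl : 0 < d j * d l by rewrite mulr_gt0.
have c x y z a b c : scale d M x a * scale d M y b - scale d M x c * scale d M y z =
   d x * d y * (M x a * M y b - M x c * M y z) by rewrite !mxE; ring.
rewrite /admissible /cofac !c (mulrC (d l)) !(pmulr_rle0 _ djl) => -[-> [->|E]]; split=> //;
  [by left|right].
rewrite (det_scale _ _ F) !mxE.
have p : 0 < d i * d j * d l * d j by rewrite !mulr_gt0.
rewrite -subr_ge0 in E; rewrite -subr_ge0; have := mulr_ge0 (ltW p) E.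
by congr (0 <= _); ring.
Qed.

Lemma admissible_add_ij t M i j l : frame i j l -> 0 <= t -> pos_mx M ->
  admissible i j l M -> admissible i j l (addrow i j t M).
Proof.
move=> F t0 [M0 dM]; have nq := frame_neq F.
rewrite /admissible det_addrow ?nq // !cofac_rowi // ?(frame23 F) // !(addrowx, addrown) ?nq //.
move=> [c1 [c2|c2]]; split=> //; [by left|right].
rewrite (le_trans c2) // mulrDr mulrDl lerDl !mulr_ge0 // oppr_ge0 //.
Qed.

Lemma admissible_add_il t M i j l : frame i j l -> 0 <= t -> pos_mx M ->
  admissible i j l M -> admissible i j l (addrow i l t M).
Proof.
move=> F t0 [M0 dM]; have nq := frame_neq F.
rewrite /admissible det_addrow ?nq // !cofac_rowi // ?(frame23 F) // !(addrowx, addrown) ?nq //.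
move=> [c1 [c2|c2]]; split=> //; [by left|right].
rewrite (le_trans c2) // mulrDr mulrDl lerDl !mulr_ge0 // oppr_ge0 //.
Qed.

Lemma admissible_add_lj t M i j l : frame i j l -> admissible i j l M ->
  admissible i j l (addrow l j t M).
Proof.
move=> F; have nq := frame_neq F.
by rewrite /admissible det_addrow ?nq // cofac_add_lj // cofac_add_jl ?(frame23 F) //
  !(addrowx, addrown) ?nq.
Qed.

(** If C_il > 0 then M_li / M_lj <= M_ji / M_jj, so row l itself satisfies the determinant
    inequality, which is linear in row j. *)
Lemma admissible_add_jl t M i j l : frame i j l -> 0 <= t -> pos_mx M ->
  admissible i j l M -> admissible i j l (addrow j l t M).
Proof.
move=> F t0 pM wM; have nq := frame_neq F; have [M0 dM] := pM.
have [_ Mj _] := diag_gt0 pM (admissible_goodman F pM wM).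
have Mii := M0 i i.
move: wM; rewrite /admissible det_addrow ?nq // cofac_add_jl // cofac_add_lj ?(frame23 F) //
  !(addrowx, addrown) ?nq //.
case=> c1; case: (lerP (cofac i l j M) 0) => [c2 _|c2 [|E]] //; split=> //; [by left|right].
rewrite [leLHS]mulrDr [leRHS]mulrDr lerD // !(mulrCA _ t) ler_wpM2l //.
rewrite -(ler_pM2r Mj).
have c3 : M j j * M l i <= M l j * M j i by move: c2; rewrite /cofac => /ltW;
  rewrite subr_ge0 (mulrC (M j j)) mulrC => c2; rewrite mulrC (mulrC (M l j)) in c2 *.
have -> : \det M * M l i * M j j = \det M * (M j j * M l i) by ring.
apply: (@le_trans _ _ (\det M * (M l j * M j i))); first by rewrite ler_pM2l.
have -> : \det M * (M l j * M j i) = M l j * (\det M * M j i) by ring.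
have -> : - cofac i j l M * M i i * M l j * M j j
  = M l j * (- cofac i j l M * M i i * M j j) by ring.
by rewrite ler_wpM2l.
Qed.

(** This addition changes C_ij at the rate - C_lj, so if C_lj < 0 the cofactor C_ij can become
    positive.  Then the condition for (l, j) takes over: its determinant inequality is affine
    in t with nonnegative slope, and holds by edet_id when C_ij vanishes. *)
Lemma admissible_add_li t M i j l : frame i j l -> 0 <= t -> pos_mx M ->
  admissible i j l M -> admissible i j l (addrow l i t M) \/ admissible l j i (addrow l i t M).
Proof.
move=> F t0 pM wM; have nq := frame_neq F; have [M0 dM] := pM.
have Fc : frame l j i by rewrite /frame !nq.
have Fl : frame l i j by rewrite /frame !nq.
have pM' : pos_mx (addrow l i t M) by apply: pos_addrow; rewrite ?nq.
have c1 : cofac i j l M <= 0 by case: wM.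
case: (lerP 0 (cofac l j i M)) => c3.
  left; have E := admissible_edet F pM wM c3; split;
    first by rewrite cofac_add_li // subr_le0 (le_trans c1) ?mulr_ge0.
  right; rewrite det_addrow ?nq // cofac_add_li // !addrown ?nq // (le_trans E) //.
  by rewrite !ler_wpM2r // lerN2 gerBl mulr_ge0.
have c3' : cofac l j i (addrow l i t M) <= 0 by rewrite cofac_rowi // ltW.
case: (lerP (cofac i j l (addrow l i t M)) 0) => c4; first by left; apply: admissible_sym.
right; split=> //; right.
rewrite det_addrow ?nq // cofac_rowi // addrowx !addrown ?nq //.
have := edet_id M Fc; rewrite -subr_ge0 => e.
have -> : - cofac l j i M * (M l l + t * M i l) * M j j - \det M * M j l
   = - cofac l j i M * M l j * M j l + (cofac i j l (addrow l i t M)) * (M i l * M j j)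
    + (- cofac i j l M) * (M i j * M j l).
  rewrite mulrDr mulrDl addrAC {}e cofac_add_li // /cofac; ring.
by rewrite !addr_ge0 ?mulr_ge0 ?oppr_ge0 // ltW.
Qed.

Lemma admissible_addrow x y t M i j l : frame i j l -> 0 <= t -> pos_mx M ->
  admissible i j l M ->
  x != y -> (x, y) != (j, i) -> admissible_any (addrow x y t M).
Proof.
move=> F t0 pM wM xy; have nq := frame_neq F.
have Fc : frame l j i by rewrite /frame !nq.
move: x y xy; apply: (frame_ind2 F) => ne.
- by exists i, j, l; split=> //; apply: admissible_add_ij.
- by rewrite eqxx in ne.
- by exists i, j, l; split=> //; apply: admissible_add_il.
- by case: (admissible_add_li F t0 pM wM); [exists i, j, l | exists l, j, i].
- by exists i, j, l; split=> //; apply: admissible_add_jl.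
- by exists i, j, l; split=> //; apply: admissible_add_lj.
Qed.

(** When Z_ij = 0 two cofactors become monomials and the determinant inequality reduces to the
    diagonal one. *)
Lemma zero_entry_admissible Z i j l : frame i j l -> pos_mx Z -> Z i j = 0 ->
  \det Z <= Z i i * Z j j * Z l l -> admissible j l i Z /\ admissible l i j Z.
Proof.
move=> F [Z0 dZ] z g; rewrite /admissible /cofac z !(mulr0, mul0r, sub0r, subr0).
split; split; rewrite ?oppr_le0 ?mulr_ge0 //; right; rewrite opprK.
  have -> : Z l j * Z i i * Z j j * Z l l = Z i i * Z j j * Z l l * Z l j by ring.
  by rewrite ler_wpM2r.
have -> : Z i l * Z j j * Z l l * Z i i = Z i i * Z j j * Z l l * Z i l by ring.
by rewrite ler_wpM2r.
Qed.

(** The two conditions of zero_entry_admissible have different exceptional additions, so no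
    addition is exceptional for both. *)
Lemma zero_entry_addrow x y t Z i j l : frame i j l -> pos_mx Z -> Z i j = 0 ->
  \det Z <= Z i i * Z j j * Z l l -> 0 <= t -> x != y -> admissible_any (addrow x y t Z).
Proof.
move=> F pZ z g t0 xy; have [w1 w2] := zero_entry_admissible F pZ z g; have nq := frame_neq F.
have F1 : frame j l i by rewrite /frame !nq.
have F2 : frame l i j by rewrite /frame !nq.
have [[-> ->]|ne] := eqVneq (x, y) (l, j); last exact: (admissible_addrow F1).
by apply: (admissible_addrow F2) => //; rewrite ?xpair_eqE ?negb_and ?nq.
Qed.

End Monotone.

(** * Commutation rules and closure under row additions *)

Section Rewriting.
Variable R : realType.
Implicit Types (M N Q Z : 'M[R]_3) (i j l x y : 'I_3) (s t u : R).

Lemma addrow0 x y M : addrow x y 0 M = M.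
Proof. by apply/matrixP=> a b; rewrite mxE mul0r addr0; case: eqP => [->|]. Qed.

Lemma addrowD x y s t M : x != y -> addrow x y s (addrow x y t M) = addrow x y (s + t) M.
Proof.
move=> xy; apply/matrixP=> a b; rewrite !mxE eqxx (eq_sym y x) (negbTE xy).
by case: eqP => // _; ring.
Qed.

Lemma addrow_row x y z s t M : x != y -> x != z ->
  addrow x y s (addrow x z t M) = addrow x z t (addrow x y s M).
Proof.
move=> xy xz; apply/matrixP=> a b; rewrite !mxE eqxx (eq_sym y x) (eq_sym z x) (negbTE xy)
  (negbTE xz).
by case: eqP => // _; ring.
Qed.

Lemma addrow_col x y z s t M : x != y -> z != x -> z != y ->
  addrow x z s (addrow y z t M) = addrow y z t (addrow x z s M).
Proof.
move=> xy zx zy; apply/matrixP=> a b; rewrite !mxE (negbTE xy) (negbTE zx) (negbTE zy).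
by rewrite (eq_sym y) (negbTE xy); case: eqP => [->|//]; rewrite (negbTE xy).
Qed.

Lemma addrow_path i j l s t M : frame i j l ->
  addrow l j t (addrow j i s M) = addrow j i s (addrow l j t (addrow l i (t * s) M)).
Proof.
move=> F; have nq := frame_neq F.
apply/matrixP; apply: (frame_ind F) => b; rewrite !(addrowx, addrown) ?nq //; ring.
Qed.

(** In the two-state subsystem {i, j} any product of two opposite additions can be reordered;
    a positive scaling of the rows is the price. *)
Lemma addrow_swap i j l s t M : frame i j l -> 0 <= s -> 0 <= t ->
  exists d s' t', [/\ forall a, 0 < d a, 0 <= s', 0 <= t' &
  addrow i j t (addrow j i s M) = addrow j i s' (scale d (addrow i j t' M))].
Proof.
move=> F s0 t0; have nq := frame_neq F.
have p : 0 < 1 + t * s by rewrite ltr_wpDr ?mulr_ge0.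
exists (fun a => if a == i then 1 + t * s else if a == j then (1 + t * s)^-1 else 1).
exists (s / (1 + t * s)), (t / (1 + t * s)); split.
- by move=> a; do !case: ifP; rewrite ?invr_gt0.
- by rewrite divr_ge0 // ltW.
- by rewrite divr_ge0 // ltW.
have ij : (i == j) = false by apply: negbTE; rewrite nq.
have li : (l == i) = false by apply: negbTE; rewrite nq.
have lj : (l == j) = false by apply: negbTE; rewrite nq.
apply/matrixP; apply: (frame_ind F) => b; rewrite !mxE ?(eqxx, ij, eq_sym j i, li, lj) /=;
  field; rewrite ?gt_eqF //.
Qed.

Lemma addrow_scale d x y t M : (forall a, 0 < d a) ->
  scale d (addrow x y t M) = addrow x y (t * d x / d y) (scale d M).
Proof.
move=> d0; apply/matrixP=> a b; rewrite !mxE; case: eqP => [->|//]; field.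
by rewrite gt_eqF.
Qed.

Definition reach1 M := exists i j l s Q,
  [/\ frame i j l, 0 <= s, pos_mx Q, admissible i j l Q & M = addrow j i s Q].

Definition reach2 M := exists i j l u s Q,
  [/\ frame i j l, 0 <= u, 0 <= s, pos_mx Q /\ admissible i j l Q &
     M = addrow i l u (addrow j i s Q)].

Lemma any_reach1 M : pos_mx M -> admissible_any M -> reach1 M.
Proof. by move=> pM [i [j [l [F w]]]]; exists i, j, l, 0, M; rewrite addrow0. Qed.

Lemma reach1_reach2 M : reach1 M -> reach2 M.
Proof.
by move=> [i [j [l [s [Q [F s0 pQ w ->]]]]]]; exists i, j, l, 0, s, Q; rewrite addrow0.
Qed.

Lemma reach1_scale d M : (forall a, 0 < d a) -> reach1 M -> reach1 (scale d M).
Proof.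
move=> d0 [i [j [l [s [Q [F s0 pQ w ->]]]]]].
exists i, j, l, (s * d j / d i), (scale d Q); split=> //; last by rewrite addrow_scale.
- by rewrite divr_ge0 ?mulr_ge0 // ltW.
- exact: pos_scale.
- exact: admissible_scale.
Qed.

Lemma any_addrow x y t M : x != y -> 0 <= t -> pos_mx M -> admissible_any M ->
  reach1 (addrow x y t M).
Proof.
move=> xy t0 pM [i [j [l [F w]]]].
have [[-> ->]|ne] := eqVneq (x, y) (j, i); first by exists i, j, l, t, M.
by apply: any_reach1; [exact: pos_addrow | exact: (admissible_addrow F)].
Qed.

(** Every addition other than E_il can be moved past E_ji, at worst producing a further
    addition that preserves admissibility. *)
Lemma reach1_addrow_commuting x y t i j l s Q : frame i j l -> 0 <= t -> 0 <= s ->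
  pos_mx Q -> admissible i j l Q -> x != y -> (x, y) != (i, l) ->
  reach1 (addrow x y t (addrow j i s Q)).
Proof.
move=> F t0 s0 pQ w xy; have nq := frame_neq F.
have Fc : frame l j i by rewrite /frame !nq.
move: x y xy; apply: (frame_ind2 F) => ne.
- have [d [s' [t' [d0 s'0 t'0 ->]]]] := addrow_swap Q F s0 t0.
  exists i, j, l, s', (scale d (addrow i j t' Q)); split=> //.
    by apply/pos_scale/pos_addrow; rewrite ?nq.
  by apply: admissible_scale => //; apply: admissible_add_ij.
- by rewrite addrowD ?nq //; exists i, j, l, (t + s), Q; split=> //; rewrite addr_ge0.
- by rewrite eqxx in ne.
- rewrite addrow_col ?nq //; apply: any_addrow; rewrite ?nq //.
    by apply: pos_addrow; rewrite ?nq.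
  by apply: (admissible_addrow F); rewrite ?nq // xpair_eqE negb_and nq.
- rewrite addrow_row ?nq //; apply: any_addrow; rewrite ?nq //.
    by apply: pos_addrow; rewrite ?nq.
  by apply: (admissible_addrow F); rewrite ?nq // xpair_eqE negb_and nq orbT.
- rewrite (addrow_path _ _ _ F); apply: any_addrow; rewrite ?nq //.
    by do 2!(apply: pos_addrow; rewrite ?nq ?mulr_ge0 //).
  have pQ' : pos_mx (addrow l i (t * s) Q) by apply: pos_addrow; rewrite ?nq ?mulr_ge0.
  case: (admissible_add_li F (mulr_ge0 t0 s0) pQ w) => w'.
    by exists i, j, l; split=> //; apply: admissible_add_lj.
  by exists l, j, i; split=> //; apply: admissible_add_ij.
Qed.

Lemma reach1_addrow x y t M : x != y -> 0 <= t -> reach1 M -> reach2 (addrow x y t M).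
Proof.
move=> xy t0 [i [j [l [s [Q [F s0 pQ w ->]]]]]].
have [[-> ->]|ne] := eqVneq (x, y) (i, l); first by exists i, j, l, t, s, Q.
exact/reach1_reach2/(reach1_addrow_commuting F).
Qed.

Lemma reach2_addrow_commuting x y t i j l u s Q : frame i j l -> 0 <= t -> 0 <= u -> 0 <= s ->
  pos_mx Q -> admissible i j l Q -> x != y -> (x, y) != (l, j) ->
  reach2 (addrow x y t (addrow i l u (addrow j i s Q))).
Proof.
move=> F t0 u0 s0 pQ w xy; have nq := frame_neq F.
have Fc : frame l i j by rewrite /frame !nq.
have ne1 x' y' : (x' != i) || (y' != l) -> (x', y') != (i, l) by rewrite xpair_eqE negb_and.
move: x y xy; apply: (frame_ind2 F) => ne.
- rewrite addrow_row ?nq //; apply: reach1_addrow; rewrite ?nq //.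
  by apply: (reach1_addrow_commuting F); rewrite ?nq // ne1 // nq orbT.
- rewrite (addrow_path _ _ _ Fc) (addrow_row (x:=j) (y:=l)) ?nq // addrowD ?nq //.
  exists i, j, l, u, (t + s), (addrow j l (t * u) Q); split; rewrite ?addr_ge0 //.
  have tu : 0 <= t * u by rewrite mulr_ge0.
  by split; [apply: pos_addrow; rewrite ?nq | apply: admissible_add_jl].
- by rewrite addrowD ?nq //; exists i, j, l, (t + u), s, Q; split; rewrite ?addr_ge0.
- have [d [u' [t' [d0 u'0 t'0 ->]]]] := addrow_swap (addrow j i s Q) Fc u0 t0.
  apply: reach1_addrow; rewrite ?nq //; apply: reach1_scale => //.
  by apply: (reach1_addrow_commuting F); rewrite ?nq // ne1 // nq.
- rewrite addrow_col ?nq //; apply: reach1_addrow; rewrite ?nq //.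
  by apply: (reach1_addrow_commuting F); rewrite ?nq // ne1 // nq.
- by rewrite eqxx in ne.
Qed.

End Rewriting.

(** * Explicit factorizations *)

Section Factorization.
Variable R : realType.
Implicit Types (M N Q Z : 'M[R]_3) (i j l x y : 'I_3) (s t u : R).

Definition diagm (d : 'I_3 -> R) : 'M[R]_3 := \matrix_(a, b) (if a == b then d a else 0).

(** Positive diagonal matrices are the length 0 case because lengths are counted up to positive
    scaling of the rows. *)
Fixpoint rowgen n M : Prop :=
  if n is n'.+1 then
    exists x y t N, [/\ x != y, 0 <= t, rowgen n' N & M = addrow x y t N]
  else exists d, (forall a, 0 < d a) /\ M = diagm d.

Lemma rowgen_add n x y t N : x != y -> 0 <= t -> rowgen n N -> rowgen n.+1 (addrow x y t N).
Proof. by move=> *; exists x, y, t, N. Qed.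

Lemma rowgenS n M : rowgen n M -> rowgen n.+1 M.
Proof.
by move=> g; rewrite -(addrow0 ord0 ord_max M); apply: rowgen_add.
Qed.

Lemma rowgen_peel n x y s M : x != y -> 0 <= s -> rowgen n (addrow x y (- s) M) ->
  rowgen n.+1 M.
Proof.
move=> xy s0 g; have -> : M = addrow x y s (addrow x y (- s) M).
  by rewrite addrowD // subrr addrow0.
exact: rowgen_add.
Qed.

(** Since Z_ij = 0, point i lies on the segment joining the vertices i and l, so only E_il can
    have moved it.  If row j keeps a nonnegative entry l when row i is subtracted from it to
    clear its entry i, then the remaining block on {j, l} is a two-state matrix.  Otherwise
    entry l of row j is cleared instead, and the inequality det <= product of the diagonal is what
    makes the coefficient of row i in row l nonnegative.  In the case of equality one of the
    five coefficients is zero. *)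
Lemma zero_entry_rowgen Z i j l : frame i j l -> pos_mx Z -> Z i j = 0 ->
  \det Z <= Z i i * Z j j * Z l l ->
  rowgen 5 Z /\ (\det Z = Z i i * Z j j * Z l l -> rowgen 4 Z).
Proof.
move=> F pZ z g; have nq := frame_neq F; have [Z0 dZ] := pZ.
have ij : (i == j) = false by apply: negbTE; rewrite nq.
have ji : (j == i) = false by apply: negbTE; rewrite nq.
have li : (l == i) = false by apply: negbTE; rewrite nq.
have lj : (l == j) = false by apply: negbTE; rewrite nq.
have il : (i == l) = false by apply: negbTE; rewrite nq.
have jl : (j == l) = false by apply: negbTE; rewrite nq.
have [m1 a2 b3] := diag_gt0 pZ g.
have [m1n a2n b3n] : [/\ Z i i != 0, Z j j != 0 & Z l l != 0] by rewrite !gt_eqF.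
pose dd d3 := fun a => if a == i then Z i i else if a == j then Z j j else d3 : R.
have dd0 d3 : 0 < d3 -> forall a, 0 < dd d3 a by move=> d30 a; rewrite /dd; do !case: ifP.
have dE := det_frame Z F; rewrite z in dE.
case: (lerP (Z i l * Z j i) (Z j l * Z i i)) => c.
  pose al := Z j i / Z i i; pose be := Z l i / Z i i; pose rho := Z l j / Z j j.
  pose a3 := Z j l - al * Z i l; pose b3' := Z l l - be * Z i l.
  pose d3 := b3' - rho * a3.
  have d3E : \det Z = Z i i * Z j j * d3.
    by rewrite dE /d3 /a3 /b3' /rho /al /be; field; rewrite m1n a2n.
  have d30 : 0 < d3 by move: dZ; rewrite d3E pmulr_rgt0 // mulr_gt0.
  have a30 : 0 <= a3 by rewrite /a3 /al subr_ge0 mulrAC ler_pdivrMr // mulrC.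
  have al0 : 0 <= al by rewrite divr_ge0.
  have be0 : 0 <= be by rewrite divr_ge0.
  have rho0 : 0 <= rho by rewrite divr_ge0.
  have tau0 : 0 <= a3 / d3 by rewrite divr_ge0 // ltW.
  have t0 : 0 <= Z i l / d3 by rewrite divr_ge0 // ltW.
  have d3n : d3 != 0 by rewrite gt_eqF.
  have E : Z = addrow l i be (addrow j i al (addrow l j rho (addrow j l (a3 / d3)
      (addrow i l (Z i l / d3) (diagm (dd d3)))))).
    apply/matrixP=> a b; rewrite !mxE /dd.
    elim/(frame_ind F): a; elim/(frame_ind F): b;
      rewrite ?(eqxx, ij, ji, li, lj, il, jl) ?z /= ?(divfK d3n, mulr0, addr0, add0r) //;
      rewrite /d3 /a3 /b3' /rho /al /be; field; rewrite ?m1n ?a2n //.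
  split; first by rewrite E; do 5!(apply: rowgen_add; rewrite ?nq //); exists (dd d3);
    split=> //; exact: dd0.
  rewrite d3E => /(mulfI _) e; have {e} : d3 = Z l l by apply: e; rewrite mulf_neq0.
  move=> e; have : rho * a3 + be * Z i l = 0.
    by move: e; rewrite {1}/d3 /b3' => e; rewrite -[RHS](subrr (Z l l)) -{2}e; ring.
  move/eqP; rewrite (paddr_eq0 (mulr_ge0 rho0 a30) (mulr_ge0 be0 (Z0 _ _))) => /andP[/eqP e2 _].
  have {e2} [r0|t30] : rho = 0 \/ a3 / d3 = 0.
    by move/eqP: e2; rewrite mulf_eq0 => /orP[/eqP->|/eqP->]; [left|right; rewrite mul0r].
    rewrite E r0 [addrow l j 0 _]addrow0; do 4!(apply: rowgen_add; rewrite ?nq //);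
      exists (dd d3); split=> //; exact: dd0.
  rewrite E t30 [addrow j l 0 _]addrow0; do 4!(apply: rowgen_add; rewrite ?nq //);
    exists (dd d3); split=> //; exact: dd0.
have m30 : 0 < Z i l.
  by rewrite lt_neqAle Z0 andbT; apply/eqP => e; move: c; rewrite -e mul0r ltNge mulr_ge0.
have m3n : Z i l != 0 by rewrite gt_eqF.
pose t5 := Z j l / Z i l; pose u1 := Z j i - t5 * Z i i.
pose t3 := Z l j / Z j j; pose t4 := (Z l i - t3 * u1) / Z i i.
pose d3 := Z l l - t4 * Z i l.
have d3E : \det Z = Z i i * Z j j * d3.
  by rewrite dE /d3 /t4 /t3 /u1 /t5; field; rewrite m1n a2n m3n.
have d30 : 0 < d3 by move: dZ; rewrite d3E pmulr_rgt0 // mulr_gt0.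
have d3n : d3 != 0 by rewrite gt_eqF.
have t40 : 0 <= t4.
  by move: g; rewrite d3E ler_pM2l ?mulr_gt0 // /d3 gerBl pmulr_lge0.
have t30 : 0 <= t3 by rewrite divr_ge0.
have t50 : 0 <= t5 by rewrite divr_ge0.
have u10 : 0 <= u1 / Z i i.
  by rewrite divr_ge0 // /u1 /t5 subr_ge0 mulrAC ler_pdivrMr // mulrC (mulrC (Z j i)) mulrC
    ltW // mulrC.
have t20 : 0 <= Z i l / d3 by rewrite divr_ge0 // ltW.
have E : Z = addrow j i t5 (addrow l i t4 (addrow l j t3 (addrow i l (Z i l / d3)
    (addrow j i (u1 / Z i i) (diagm (dd d3)))))).
  apply/matrixP=> a b; rewrite !mxE /dd.
  elim/(frame_ind F): a; elim/(frame_ind F): b;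
    rewrite ?(eqxx, ij, ji, li, lj, il, jl) ?z /= ?(divfK d3n, mulr0, addr0, add0r) //;
    rewrite /d3 /t4 /t3 /u1 /t5; field; rewrite ?m1n ?a2n ?m3n //.
split; first by rewrite E; do 5!(apply: rowgen_add; rewrite ?nq //); exists (dd d3);
  split=> //; exact: dd0.
rewrite d3E => /(mulfI _) e; have {e} : d3 = Z l l by apply: e; rewrite mulf_neq0.
move=> e; have : t4 * Z i l = 0 by move: e; rewrite {1}/d3 => e;
  rewrite -[RHS](subrr (Z l l)) -{2}e; ring.
move/eqP; rewrite mulf_eq0 (negbTE m3n) orbF => /eqP e4.
by rewrite E e4 [addrow l i 0 _]addrow0; do 4!(apply: rowgen_add; rewrite ?nq //);
  exists (dd d3); split=> //; exact: dd0.
Qed.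

(** Subtracting row j from row l until entry i vanishes; the determinant inequality becomes the
    diagonal one for the result. *)
Lemma admissible_rowgen_strict M i j l : frame i j l -> pos_mx M -> 0 < cofac i l j M ->
  cofac i j l M <= 0 ->
  \det M * M j i <= - cofac i j l M * M i i * M j j ->
  rowgen 6 M /\ (\det M * M j i = - cofac i j l M * M i i * M j j -> rowgen 5 M).
Proof.
move=> F pM c2 c1 E; have nq := frame_neq F; have [M0 dM] := pM.
have p : 0 < M j i.
  rewrite lt_neqAle M0 andbT; apply/eqP => e; move: c2;
    rewrite /cofac -e mulr0 sub0r oppr_gt0 ltNge.
  by rewrite mulr_ge0.
have pn : M j i != 0 by rewrite gt_eqF.
pose s := M l i / M j i; have s0 : 0 <= s by rewrite divr_ge0.
pose Z := addrow l j (- s) M.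
have Zli : Z l i = 0 by rewrite /Z addrowx /s; field.
have Zll : Z l l = - cofac i j l M / M j i by rewrite /Z addrowx /s /cofac; field.
have Zlj : Z l j = cofac i l j M / M j i by rewrite /Z addrowx /s /cofac; field.
have dZ : \det Z = \det M by rewrite /Z det_addrow ?nq.
have [Zi Zj] : Z i i = M i i /\ Z j j = M j j by rewrite /Z !addrown ?nq.
have pZ : pos_mx Z.
  split; last by rewrite dZ.
  apply: (frame_ind F) => b; [by rewrite addrown ?nq | by rewrite addrown ?nq | ].
  elim/(frame_ind F): b; rewrite ?Zli ?Zlj ?Zll // divr_ge0 ?oppr_ge0 // ltW //.
have Fl : frame l i j by rewrite /frame !nq.
have e : Z l l * Z i i * Z j j = (- cofac i j l M * M i i * M j j) / M j i
  by rewrite Zll Zi Zj; field.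
have g : \det Z <= Z l l * Z i i * Z j j by rewrite e dZ ler_pdivlMr.
have [g5 g4] := zero_entry_rowgen Fl pZ Zli g.
split; first by apply: (rowgen_peel _ s0 g5); rewrite nq.
move=> E'; apply: (@rowgen_peel _ l j s); rewrite ?nq //; apply: g4.
by rewrite e dZ -E'; field.
Qed.

Lemma admissible_rowgen M i j l : frame i j l -> pos_mx M -> admissible i j l M -> rowgen 6 M.
Proof.
move=> F pM wM; have nq := frame_neq F; have [M0 dM] := pM.
have g := admissible_goodman F pM wM; have [Mi Mj Ml] := diag_gt0 pM g.
have Fl : frame l i j by rewrite /frame !nq.
case: wM => c1; case: (lerP (cofac i l j M) 0) => [c2 _|c2 [|E]] //; last first.
  by have [] := admissible_rowgen_strict F pM c2 c1 E.
have [zli|nli] := eqVneq (M l i) 0.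
  apply: rowgenS; apply: (proj1 (zero_entry_rowgen Fl pM zli _)).
  by rewrite -mulrA mulrC.
have Mjn : M j j != 0 by rewrite gt_eqF.
pose s := M l j / M j j; have s0 : 0 <= s by rewrite divr_ge0.
pose Z := addrow l j (- s) M.
have Zlj : Z l j = 0 by rewrite /Z addrowx /s; field.
have Zli : Z l i = - cofac i l j M / M j j by rewrite /Z addrowx /s /cofac; field.
have dZ : \det Z = \det M by rewrite /Z det_addrow ?nq.
have [Zi Zj] : Z i i = M i i /\ Z j j = M j j by rewrite /Z !addrown ?nq.
have cZ : cofac i j l Z = cofac i j l M by rewrite /Z cofac_add_lj.
have Zll : 0 <= Z l l.
  have -> : Z l l = (M l l * M j j - M l j * M j l) / M j j by rewrite /Z addrowx /s; field.
  rewrite divr_ge0 // subr_ge0.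
  have [e|ne] := eqVneq (M j i) 0.
    move: c1; rewrite /cofac e mul0r subr0 => c1.
    have /eqP : M j l * M l i = 0 by apply/le_anti; rewrite c1 mulr_ge0.
    by rewrite mulf_eq0 (negbTE nli) orbF => /eqP ->; rewrite mulr0 mulr_ge0.
  have p : 0 < M j i by rewrite lt_neqAle eq_sym ne M0.
  rewrite -(ler_pM2r p); move: c1 c2; rewrite /cofac !subr_le0 => c1 c2.
  have -> : M l j * M j l * M j i = (M l j * M j i) * M j l by ring.
  apply: (le_trans (ler_wpM2r (M0 j l) c2)).
  have -> : M l i * M j j * M j l = (M j l * M l i) * M j j by ring.
  have -> : M l l * M j j * M j i = (M j i * M l l) * M j j by ring.
  exact: ler_wpM2r.
have pZ : pos_mx Z.
  split; last by rewrite dZ.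
  apply: (frame_ind F) => b; [by rewrite addrown ?nq | by rewrite addrown ?nq | ].
  by elim/(frame_ind F): b => //; rewrite ?Zlj // Zli divr_ge0 ?oppr_ge0 // ltW.
have Flj : frame l j i by rewrite /frame !nq.
apply: (@rowgen_peel _ l j s); rewrite ?nq //; apply: (proj1 (zero_entry_rowgen Flj pZ Zlj _)).
have [Z0 _] := pZ.
rewrite -subr_ge0; suff -> : Z l l * Z j j * Z i i - \det Z
  = Z j j * Z i l * Z l i + Z i j * (- cofac i j l Z).
  by rewrite cZ addr_ge0 ?mulr_ge0 ?oppr_ge0.
by rewrite (det_frame _ F) Zlj /cofac; ring.
Qed.

End Factorization.

(** * The first admissible matrix on a path *)

Section FirstEntry.
Variable R : realType.
Implicit Types (M N Q Z : 'M[R]_3) (i j l x y : 'I_3) (s t u : R).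

Lemma quadratic_ivt (e0 e1 e2 s : R) : 0 <= s -> 0 <= e0 -> e0 + e1 * s + e2 * s ^+ 2 <= 0 ->
  exists2 r, 0 <= r <= s & e0 + e1 * r + e2 * r ^+ 2 = 0.
Proof.
move=> s0 h0 hs; pose p := - (e0%:P + e1 *: 'X + e2 *: 'X^2).
have pE r : p.[r] = - (e0 + e1 * r + e2 * r ^+ 2) by rewrite /p !hornerE.
have [|r rle /rootP] := @poly_ivt R p 0 s s0.
  by rewrite !pE oppr_le0 oppr_ge0 hs mulr0 expr0n mulr0 !addr0 h0.
by rewrite pE => /eqP; rewrite oppr_eq0 => /eqP e; exists r.
Qed.

Lemma admissible_swap Q i j l : admissible i j l Q -> cofac i l j Q <= 0 -> admissible i l j Q.
Proof. by move=> [c1 _] c2; split=> //; left. Qed.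

(** Let row j lose its multiple of row i gradually.  Unless the matrix is already admissible,
    the determinant inequality fails at the start and holds at the end, so it is an equality at
    some point in between, where admissible_rowgen_strict saves one addition. *)
Lemma reach1_rowgen i j l s Q : frame i j l -> 0 <= s -> pos_mx Q -> admissible i j l Q ->
  rowgen 6 (addrow j i s Q).
Proof.
move=> F s0 pQ w; have nq := frame_neq F.
have pN t : 0 <= t -> pos_mx (addrow j i t Q) by move=> t0; apply: pos_addrow; rewrite ?nq.
have [[i' [j' [l' [F' w']]]]|nW] := pselect (admissible_any (addrow j i s Q)).
  exact: (admissible_rowgen F' (pN s s0) w').
pose E r := - cofac i j l (addrow j i r Q) * Q i i * (addrow j i r Q) j j
   - \det Q * (addrow j i r Q) j i.
have ii r : addrow j i r Q i i = Q i i by rewrite addrown ?nq.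
pose c1 := Q i l * Q l i - Q i i * Q l l.
have cE r : cofac i j l (addrow j i r Q) = cofac i j l Q + r * c1.
  by rewrite /cofac /c1 !(addrowx, addrown) ?nq //; ring.
pose e0 := - cofac i j l Q * Q i i * Q j j - \det Q * Q j i.
pose e1 := - cofac i j l Q * Q i i * Q i j - c1 * Q i i * Q j j - \det Q * Q i i.
pose e2 := - c1 * Q i i * Q i j.
have EE r : E r = e0 + e1 * r + e2 * r ^+ 2.
  by rewrite /E cE !addrowx /e0 /e1 /e2; ring.
have sub r Q' : 0 <= r <= s -> Q' = addrow j i r Q -> admissible i j l Q' -> 0 < cofac i l j Q'.
  move=> /andP[r0 rle] Q'E wr; rewrite ltNge; apply/negP => c; apply: nW.
  have -> : addrow j i s Q = addrow j i (s - r) Q' by rewrite Q'E addrowD ?nq // subrK.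
  have F2 := frame23 F.
  apply: (admissible_addrow F2); rewrite ?subr_ge0 ?nq // ?Q'E; first exact: pN.
    by rewrite -Q'E; apply: admissible_swap.
  by rewrite xpair_eqE negb_and nq.
have diagpos r : 0 <= r -> 0 < Q i i /\ 0 < addrow j i r Q j j.
  move=> r0; have [Q0 _] := pQ; have [Qi Qj _] := diag_gt0 pQ (admissible_goodman F pQ w).
  by split=> //; rewrite addrowx ltr_wpDr // mulr_ge0.
have E0 : 0 <= e0.
  have := sub 0 Q; rewrite addrow0 lexx s0 => /(_ isT erefl w) c.
  by rewrite /e0 subr_ge0; case: w => _ [/(lt_le_trans c)|//]; rewrite ltxx.
have good r : 0 <= r -> 0 <= E r -> cofac i j l (addrow j i r Q) <= 0.
  move=> r0; have [Qi Qj] := diagpos r r0; have [N0 dN] := pN r r0.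
  rewrite /E subr_ge0 => h; rewrite -oppr_ge0 -(pmulr_lge0 _ Qi) -(pmulr_lge0 _ Qj).
  by apply: le_trans h; rewrite mulr_ge0 // ltW //; case: pQ.
have Es : e0 + e1 * s + e2 * s ^+ 2 <= 0.
  rewrite -EE leNgt; apply/negP => /ltW h; apply: nW; exists i, j, l; split=> //; split;
    first exact: good.
  by right; rewrite det_addrow ?nq // ii -subr_ge0.
have [r rle Er] := quadratic_ivt s0 E0 Es; rewrite -EE in Er.
have [r0 rs'] := andP rle.
have c := good r r0; rewrite Er lexx in c; have {}c := c isT.
have Er' : \det (addrow j i r Q) * addrow j i r Q j i =
   - cofac i j l (addrow j i r Q) * addrow j i r Q i i * addrow j i r Q j j.
  by apply/esym/eqP; rewrite -subr_eq0 det_addrow ?nq // ii; apply/eqP.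
have wr : admissible i j l (addrow j i r Q) by split=> //; right; rewrite Er'.
have cs := sub r _ rle erefl wr.
have -> : addrow j i s Q = addrow j i (s - r) (addrow j i r Q) by rewrite addrowD ?nq // subrK.
apply: rowgen_add; rewrite ?nq ?subr_ge0 //.
by apply: (proj2 (admissible_rowgen_strict F (pN r r0) cs c _)); rewrite ?Er'.
Qed.

Lemma reach2_rowgen M : reach2 M -> rowgen 7 M.
Proof.
move=> [i [j [l [u [s [Q [F u0 s0 [pQ w] ->]]]]]]].
by apply: rowgen_add; rewrite ?(frame_neq F) //; apply: (reach1_rowgen F).
Qed.

End FirstEntry.

(** * Second-order conditions at a local maximum *)

Section SecondOrder.
Variable R : realType.
Implicit Types (e : R).

Lemma poly_ge0_at0 (p : {poly R}) d : 0 < d -> (forall e, 0 < e < d -> 0 <= p.[e]) ->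
  0 <= p.[0].
Proof.
move=> d0 h; rewrite leNgt; apply/negP => p0.
have /nbhs_ballP[r /= r0 H] : \forall e \near (0 : R), p.[e] < 0.
  exact: (cvgr_lt _ (@continuous_horner R p 0) 0 p0).
pose e := Num.min r d / 2.
have m0 : 0 < Num.min r d by rewrite lt_min r0 d0.
have e0 : 0 < e by rewrite divr_gt0.
have em : e < Num.min r d by rewrite ltr_pdivrMr // ltr_pMr // ltr1n.
have := H e; rewrite /ball /= sub0r normrN gtr0_norm // => H'.
have := H' (lt_le_trans em _); rewrite ge_min lexx => /(_ isT); apply/negP; rewrite -leNgt.
by apply: h; rewrite e0 /= (lt_le_trans em) // ge_min lexx orbT.
Qed.

Lemma second_order (p : {poly R}) a1 a2 d : 0 < d ->
  (forall e, `|e| < d -> 0 <= a1 * e + a2 * e ^+ 2 + e ^+ 3 * p.[e]) ->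
  a1 = 0 /\ 0 <= a2.
Proof.
move=> d0 h.
have A b1 b2 (q : {poly R}) : (forall e, 0 < e < d ->
  0 <= b1 * e + b2 * e ^+ 2 + e ^+ 3 * q.[e]) -> 0 <= b1.
  move=> h'; have := @poly_ge0_at0 (b1%:P + b2 *: 'X + 'X^2 * q) d d0.
  have -> : (b1%:P + b2 *: 'X + 'X^2 * q).[0] = b1 by rewrite !hornerE; ring.
  apply => e ed; rewrite !hornerE.
  have [e0 _] := andP ed.
  rewrite -(pmulr_rge0 _ e0); have := h' e ed; congr (0 <= _); ring.
have a10 : a1 = 0.
  apply/le_anti/andP; split.
    rewrite -oppr_ge0; apply: (A (- a1) a2 (- (p \Po (- 'X)))) => e /andP[e0 ed].
    have := h (- e); rewrite normrN gtr0_norm // => /(_ ed);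
      rewrite hornerN horner_comp hornerN hornerX; congr (0 <= _); ring.
  apply: (A a1 a2 p) => e /andP[e0 ed]; apply: h; rewrite gtr0_norm //.
split=> //; have := @poly_ge0_at0 (a2%:P + 'X * p) d d0.
have -> : (a2%:P + 'X * p).[0] = a2 by rewrite !hornerE; ring.
apply => e /andP[e0 ed]; rewrite !hornerE.
have e20 : 0 < e ^+ 2 by rewrite exprn_gt0.
rewrite -(pmulr_rge0 _ e20); have := h e; rewrite gtr0_norm // a10 => /(_ ed);
  congr (0 <= _); ring.
Qed.

(** The gain below is a product of three factors compared with a fourth one, all polynomial
    along a line; only their coefficients up to order two matter. *)
Lemma product_max (a1 a2 b1 b2 b3 m1 m2 d1 d2 d3 d : R) : 0 < d ->
  (forall e, `|e| < d -> (1 + a1 * e + a2 * e ^+ 2) * (1 + b1 * e + b2 * e ^+ 2 + b3 * e ^+ 3)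
     * (1 + m1 * e + m2 * e ^+ 2) <= 1 + d1 * e + d2 * e ^+ 2 + d3 * e ^+ 3) ->
  d1 = a1 + b1 + m1 /\ a2 + b2 + m2 + a1 * b1 + a1 * m1 + b1 * m1 <= d2.
Proof.
move=> d0 h.
pose p0 := d3 - (b3 + a1 * b2 + a1 * m2 + a2 * b1 + a2 * m1 + b1 * m2 + b2 * m1 + a1 * b1 * m1).
pose p1 := - (a1 * b3 + a2 * b2 + a2 * m2 + b2 * m2 + b3 * m1 + a1 * b1 * m2 + a1 * b2 * m1 +
  a2 * b1 * m1).
pose p2 := - (a2 * b3 + b3 * m2 + a1 * b2 * m2 + a1 * b3 * m1 + a2 * b1 * m2 + a2 * b2 * m1).
pose p3 := - (a1 * b3 * m2 + a2 * b2 * m2 + a2 * b3 * m1).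
pose p4 := - (a2 * b3 * m2).
have [|] := @second_order (p0%:P + p1 *: 'X + p2 *: 'X^2 + p3 *: 'X^3 + p4 *: 'X^4)
  (d1 - (a1 + b1 + m1)) (d2 - (a2 + b2 + m2 + a1 * b1 + a1 * m1 + b1 * m1)) d d0.
  move=> e /h; rewrite -subr_ge0; congr (0 <= _).
  by rewrite !(hornerD, hornerC, hornerZ, hornerX, hornerXn) /p0 /p1 /p2 /p3 /p4; ring.
by move=> /eqP; rewrite subr_eq0 => /eqP -> ; rewrite subr_ge0.
Qed.

End SecondOrder.

(** * The critical configurations *)

Section Critical.
Variable R : realType.
Implicit Types (c f b d s u w v z : R).

(** Rows 1, 2, 3 of q stand for rows j, i, l of Q, so that r is row j of E_ji(s) Q.  Changing the
    parameters (w, u, s) of a decomposition by (w, v, z) replaces q by p.  The value is the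
    decrease of - C_ij Q_ii Q_jj / Q_ji times both denominators. *)
Definition gain q11 q12 q13 q21 q22 q23 q31 q32 q33 s u w v z : R :=
  let r11 := q11 + s * q21 in let r12 := q12 + s * q22 in let r13 := q13 + s * q23 in
  let p31 := q31 - w * r11 in let p32 := q32 - w * r12 in let p33 := q33 - w * r13 in
  let p21 := q21 - v * q31 + (u + v) * w * r11 in
  let p22 := q22 - v * q32 + (u + v) * w * r12 in
  let p23 := q23 - v * q33 + (u + v) * w * r13 in
  let p11 := r11 - (s + z) * p21 in
  let p12 := r12 - (s + z) * p22 in
  let p13 := r13 - (s + z) * p23 in
  q22 * q11 * (q33 * q12 - q32 * q13) * p12
  - q12 * (p22 * p11 * (p33 * p12 - p32 * p13)).

Definition locally_max q11 q12 q13 q21 q22 q23 q31 q32 q33 s u :=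
  forall w v z : R, exists2 r, 0 < r & forall e, `|e| < r ->
    0 <= gain q11 q12 q13 q21 q22 q23 q31 q32 q33 s u (e * w) (e * v) (e * z).

(** By row and column scaling q can be normalized to q11 = q12 = q22 = q33 = 1 and
    q31 - q32 = 1.  The function to be maximized is then a product of factors whose expansions
    along the direction (w, v, z) can be written down. *)
Lemma crit_expansion c f b d s u w v z : let A := 1 - f * b in 0 < A ->
  locally_max 1 1 b c 1 d (1 + f) f 1 s u ->
  let C := 1 - d * f in let G := u * (A + s * C) + (d - b) in
  let a1 := - f * v + u * (1 + s) * w in let a2 := v * w * (1 + s) in
  let n1 := - (1 + f) * v + u * (1 + s * c) * w in let n2 := v * w * (1 + s * c) in
  let b1 := - (s * n1 + z * c) in let b2 := - (s * n2 + z * n1) in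
  let m1 := - (s * w * G + z * C) / A in let m2 := - (z * w * G) / A in
  let d1 := - (s * a1 + z) in let d2 := - (s * a2 + z * a1) in
  d1 = a1 + b1 + m1 /\ a2 + b2 + m2 + a1 * b1 + a1 * m1 + b1 * m1 <= d2.
Proof.
move=> A A0 H C G a1 a2 n1 n2 b1 b2 m1 m2 d1 d2.
have [r r0 h] := H w v z.
apply: (@product_max R a1 a2 b1 b2 (- (z * n2)) m1 m2 d1 d2 (- (z * a2)) r r0) => e /h h'.
rewrite -subr_ge0 -(pmulr_rge0 _ A0); move: h'; congr (0 <= _).
have An : A != 0 by rewrite gt_eqF.
rewrite /gain /m1 /m2 /d1 /d2 /b1 /b2 /n1 /n2 /a1 /a2 /G /C /A; field.
exact: An.
Qed.

Lemma crit_first c f b d s u : 0 < c -> 0 < f -> 0 < 1 - f * b ->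
  locally_max 1 1 b c 1 d (1 + f) f 1 s u ->
  [/\ s = f, u = c & f * d = f * b + c * (1 - f * b)].
Proof.
move=> c0 f0 A0 H; have An : 1 - f * b != 0 by rewrite gt_eqF.
have [ez _] := @crit_expansion c f b d s u 0 0 1 A0 H.
have [ev _] := @crit_expansion c f b d s u 0 1 0 A0 H.
have [ew _] := @crit_expansion c f b d s u 1 0 0 A0 H.
have sf : s = f.
  apply: (addIr (- f + s * (1 + f) - s * f)); move: ev.
  rewrite !(mulr0, mul0r, mulr1, addr0, add0r, subr0, oppr0) => ev.
  by lra.
have dE : f * d = f * b + c * (1 - f * b).
  move: ez; rewrite !(mulr0, mul0r, mulr1, mul1r, addr0, add0r, subr0, oppr0) => /eqP.
  rewrite -subr_eq0 => /eqP ez.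
  have {}ez : (1 - d * f) / (1 - f * b) = 1 - c by lra.
  have {}ez : 1 - d * f = (1 - c) * (1 - f * b) by rewrite -ez divfK.
  by lra.
split=> //; move: ew; rewrite {}sf.
rewrite !(mulr0, mul0r, mulr1, mul1r, addr0, add0r, subr0, oppr0).
have -> : d - b = c * (1 - f * b) / f.
  apply: (mulfI (lt0r_neq0 f0)); rewrite mulrBr dE; field; exact: lt0r_neq0.
have -> : 1 - d * f = (1 - c) * (1 - f * b) by rewrite mulrC dE; ring.
have -> : - (f * (u * (1 - f * b + f * ((1 - c) * (1 - f * b))) + c * (1 - f * b) / f)) / (1 -
  f * b)
  = - (f * u * (1 + f * (1 - c)) + c) by field; rewrite An lt0r_neq0.
lra.
Qed.

(** The second-order coefficient at the critical configuration; 1 - f b has cancelled, which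
    leaves the two parameters c and f. *)
Lemma crit_form c f b d (g := 1 + f - f * c + f^-1) (z v w : R) : 0 < c -> 0 < f ->
  0 < 1 - f * b ->
  f * d = f * b + c * (1 - f * b) ->
  locally_max 1 1 b c 1 d (1 + f) f 1 f c ->
  let a1 := - f * v + c * (1 + f) * w in let a2 := v * w * (1 + f) in
  let n1 := - (1 + f) * v + c * (1 + f * c) * w in let n2 := v * w * (1 + f * c) in
  let b1 := - (f * n1 + z * c) in let b2 := - (f * n2 + z * n1) in
  let m1 := - (f * w * (c * g) + z * (1 - c)) in let m2 := - (z * w * (c * g)) in
  let d2 := - (f * a2 + z * a1) in
  is_true (a2 + b2 + m2 + a1 * b1 + a1 * m1 + b1 * m1 <= d2).
Proof.
move=> c0 f0 A0 dE H a1 a2 n1 n2 b1 b2 m1 m2 d2.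
have An : 1 - f * b != 0 by rewrite gt_eqF.
have [_ h] := @crit_expansion c f b d f c w v z A0 H; move: h.
have -> : d - b = c * (1 - f * b) / f.
  apply: (mulfI (lt0r_neq0 f0)); rewrite mulrBr dE; field; exact: lt0r_neq0.
have -> : 1 - d * f = (1 - c) * (1 - f * b) by rewrite mulrC dE; ring.
set G := c * (1 - f * b + _) + _.
have -> : G = (c * g) * (1 - f * b) by rewrite /G /g; field; exact: lt0r_neq0.
have -> : - (f * w * (c * g * (1 - f * b)) + z * ((1 - c) * (1 - f * b))) / (1 - f * b) = m1
  by rewrite /m1; field.
have -> : - (z * w * (c * g * (1 - f * b))) / (1 - f * b) = m2 by rewrite /m2; field.
exact.
Qed.

(** With g = (1 + f + f^2 - f^2 c) / f, the claim is g <= 0.  Suppose g > 0.  If f c < 1 + f the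
    form of crit_form takes a negative value with w = 0; otherwise it does so on a direction
    along which the entry q22 is stationary. *)
Lemma crit_second c f b d : 0 < c -> 1 <= f -> 0 < 1 - f * b ->
  f * d = f * b + c * (1 - f * b) ->
  locally_max 1 1 b c 1 d (1 + f) f 1 f c ->
  f + f ^+ 2 + 1 <= f ^+ 2 * c.
Proof.
move=> c0 f1 A0 dE H; have f0 : 0 < f by exact: lt_le_trans ltr01 f1.
have fn := lt0r_neq0 f0.
pose g := 1 + f - f * c + f^-1.
have Q z v w := crit_form z v w c0 f0 A0 dE H.
have c1 : 1 <= c.
  have := Q 1 0 0 => /= h; have : 0 <= c * (c - 1) by lra.
  by rewrite pmulr_rge0 // subr_ge0.
rewrite leNgt; apply/negP => hg.
have g0 : 0 < g.
  have -> : g = (f + f ^+ 2 + 1 - f ^+ 2 * c) / f by rewrite /g; field.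
  by rewrite divr_gt0 // subr_gt0.
case: (ltrP (f * c) (1 + f)) => hc.
  (* for fixed z the form is smallest at the corresponding value of v *)
  pose B := c * f * (1 + f) - f ^+ 2 + 1.
  have := Q (2 * (1 + f) * f ^+ 2) B 0 => /= h.
  have {h} : 0 <= (1 + f) * f ^+ 2 * (4 * c * (c - 1) * (1 + f) * f ^+ 2 - B ^+ 2).
    move: h; rewrite -subr_ge0; congr (0 <= _); rewrite /B; ring.
  have p1 : 0 < 1 + f by lra.
  have p2 : 0 < f ^+ 2 by rewrite exprn_gt0.
  rewrite (pmulr_rge0 _ (mulr_gt0 p1 p2)).
  have -> : 4 * c * (c - 1) * (1 + f) * f ^+ 2 - B ^+ 2
    = - ((1 + f) * (1 + f - f * c) * ((3 - f) * (f * c) + (f - 1) ^+ 2)) by rewrite /B; ring.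
  rewrite oppr_ge0 leNgt => /negP; apply; apply: mulr_gt0; first by rewrite mulr_gt0 ?subr_gt0.
  have fc0 : 0 < f * c by rewrite mulr_gt0.
  case: (lerP f 3) => hf.
    have [->|ne] := eqVneq f 1; first by rewrite subrr expr0n addr0 mulr_gt0 // ?mul1r //; lra.
    have sq : 0 < (f - 1) ^+ 2 by rewrite exprn_gt0 // subr_gt0 lt_neqAle eq_sym ne.
    by apply: ltr_wpDl => //; rewrite mulr_ge0 ?subr_ge0 // ltW.
  have : (f - 3) * (f * c) < (f - 3) * (1 + f) by rewrite ltr_pM2l // subr_gt0.
  have -> : (3 - f) * (f * c) = - ((f - 3) * (f * c)) by ring.
  have -> : (f - 1) ^+ 2 = (f - 3) * (1 + f) + 4 by ring.
  by lra.
have t0 : 0 < f * c * g * (2 * c - 1) by rewrite !mulr_gt0 //; lra.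
(* with this w the mixed term in z and w exceeds the term in z alone *)
pose w := (c * (c - 1) + 1) / (f * c * g * (2 * c - 1)).
have := Q 1 (c * (1 + f) * w / f) w => /= h.
have : c * (c - 1) - f * c * g * (2 * c - 1) * w - c * g * (f * c - 1 - f) * (f ^+ 2 * c - 1)
  * w ^+ 2 >= 0.
  move: h; rewrite -subr_ge0; congr (0 <= _); rewrite /g; field; exact: fn.
have -> : f * c * g * (2 * c - 1) * w = c * (c - 1) + 1 by rewrite /w mulrC divfK // gt_eqF.
have : 0 <= c * g * (f * c - 1 - f) * (f ^+ 2 * c - 1) * w ^+ 2.
  rewrite mulr_ge0 ?sqr_ge0 // mulr_ge0 // ?mulr_ge0 ?(ltW c0) ?(ltW g0) //; first by lra.
  by rewrite subr_ge0 -[leLHS]mulr1 ler_pM // exprn_ege1.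
lra.
Qed.

End Critical.

(** * Leaving a critical configuration *)

Section Escape.
Variable R : realType.
Implicit Types (c f b d s u w v z : R).

(** Half of the largest multiple of row 3 that can be subtracted from row 1, namely
    (1 + 1/f) / 2, is enough to reach the cofactor condition for (3, 1). *)
Lemma escape_normalized c f b d (k := 1 - f * b) (sg := (1 + f^-1) / 2) :
  0 < c -> 1 <= f -> 0 <= b -> 0 < k -> f * d = f * b + c * k ->
  f + f ^+ 2 + 1 <= f ^+ 2 * c ->
  let z1 := 1 + f * c - sg * (1 + f) in
  let z2 := 1 + f - sg * f in
  let z3 := b + f * d - sg in
  let C := z2 * (d + c) - z3 * (1 + c * f) in
  [/\ 0 <= z1, 0 <= z2, 0 <= z3, C <= 0 & k * (1 - c + c / f) * z3 <= - C * z1].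
Proof.
move=> c0 f1 b0 k0 dE hg z1 z2 z3 C.
have f0 : 0 < f by exact: lt_le_trans ltr01 f1.
have fn := lt0r_neq0 f0.
pose e := f^-1; have e0 : 0 < e by rewrite invr_gt0.
have e1 : e <= 1 by rewrite invf_le1.
have fe : f * e = 1 by rewrite mulfV.
have kE : f * b = 1 - k by rewrite /k; ring.
clearbody k.
have bE : b = (1 - k) * e by apply: (mulfI fn); rewrite kE /e; field.
have dE' : d = (1 - k + c * k) * e by apply: (mulfI fn); rewrite dE kE /e; field.
have k1 : k <= 1 by rewrite -subr_ge0 -kE mulr_ge0 // ltW.
have cge : 1 + e + e ^+ 2 <= c.
  rewrite -(ler_pM2l (exprn_gt0 2 f0)); apply: le_trans hg; rewrite le_eqVlt; apply/orP; left.
  by apply/eqP; rewrite /e; field.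
have c1 : 0 <= c - 1 by rewrite subr_ge0; apply: le_trans cge;
  rewrite -addrA lerDl addr_ge0 // ?sqr_ge0 // ltW.
have z1ge : 1 + e <= z1.
  have : 1 + f + e <= f * c.
    rewrite -(ler_pM2l f0); move: hg; congr (_ <= _); last by ring.
    by rewrite /e; field.
  have -> : z1 = 1 + f * c - (2 + f + e) / 2 by rewrite /z1 /sg /e; field.
  lra.
have z2ge : 0 <= z2.
  have -> : z2 = (1 + f) / 2 by rewrite /z2 /sg; field.
  by rewrite divr_ge0 // addr_ge0 // ltW.
have z3E : z3 = (1 + e) / 2 + k * (c - 1 - e) by rewrite /z3 bE dE' /sg /e; field.
have ce : 0 <= c - 1 - e by have := sqr_ge0 e; lra.
have h12 : 0 <= (1 + e) / 2 by lra.
have z3ge : 0 <= z3 by rewrite z3E (addr_ge0 h12 (mulr_ge0 (ltW k0) ce)).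
pose m := f * c - 1 - f - e.
have m0 : 0 <= m.
  have -> : m = (f ^+ 2 * c - (f + f ^+ 2 + 1)) / f by rewrite /m /e; field.
  by rewrite divr_ge0 ?subr_ge0 // ltW.
have CE : - C = k * (c * m + (1 + e) / 2 * (c - 1)).
  by rewrite /C /z3 /z2 bE dE' /m /sg /e; field.
have C0 : 0 <= - C.
  by rewrite CE (mulr_ge0 (ltW k0) (addr_ge0 (mulr_ge0 (ltW c0) m0) (mulr_ge0 h12 c1))).
split=> //; first by lra.
  by rewrite -oppr_ge0.
rewrite CE -mulrA -[leRHS]mulrA ler_pM2l //.
have x1 : z3 <= c - (1 + e) / 2.
  have : k * (c - 1 - e) <= c - 1 - e by rewrite ler_piMl.
  by rewrite z3E; lra.
have x2 : 1 - c + c / f <= e ^+ 3.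
  have -> : 1 - c + c / f = 1 - c * (1 - e) by rewrite /e; ring.
  have : (1 + e + e ^+ 2) * (1 - e) <= c * (1 - e) by rewrite ler_wpM2r // subr_ge0.
  have -> : (1 + e + e ^+ 2) * (1 - e) = 1 - e ^+ 3 by ring.
  lra.
have e3 : 0 <= e ^+ 3 by rewrite exprn_ge0 // ltW.
have e31 : e ^+ 3 <= e ^+ 2 by rewrite exprS ler_piMl // ?sqr_ge0.
apply: (@le_trans _ _ (e ^+ 3 * (c - (1 + e) / 2))).
  apply: (@le_trans _ _ (e ^+ 3 * z3)); first exact: ler_wpM2r.
  exact: ler_wpM2l.
have z12 : 2 <= z1.
  have : 0 <= (f - 1) ^+ 2 * e by rewrite mulr_ge0 ?sqr_ge0 // ltW.
  have -> : (f - 1) ^+ 2 * e = f + e - 2 by rewrite /e; field.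
  have -> : z1 = m + 1 + (f + e) / 2 by rewrite /z1 /m /sg /e; field.
  lra.
have y1 : (1 + e) / 2 * (c - 1) * 2 <= (c * m + (1 + e) / 2 * (c - 1)) * z1.
  have x0 : 0 <= (1 + e) / 2 * (c - 1) := mulr_ge0 h12 c1.
  apply: (@le_trans _ _ ((1 + e) / 2 * (c - 1) * z1)); first exact: ler_wpM2l.
  by rewrite ler_wpM2r ?lerDr ?mulr_ge0 // ?(ltW c0) //; lra.
apply: le_trans y1.
have -> : e ^+ 3 * (c - (1 + e) / 2) = e ^+ 3 * (c - 1) + e ^+ 3 * ((1 - e) / 2) by field.
have -> : (1 + e) / 2 * (c - 1) * 2 = e * (c - 1) + (c - 1) by field.
apply: lerD.
  by rewrite ler_wpM2r // exprS ler_piMr ?(ltW e0) // exprn_ile1 // ltW.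
have : e ^+ 3 * ((1 - e) / 2) <= e ^+ 3 by rewrite ler_piMr //; lra.
lra.
Qed.

(** Scaling rows and columns of q rescales the decomposition parameters and multiplies the gain
    by a positive constant. *)
Lemma locally_max_scale (p2 p3 g1 g2 g3 : R) c f b d s u :
  0 < p2 -> 0 < p3 -> 0 < g1 -> 0 < g2 -> 0 < g3 ->
  locally_max g1 g2 (b * g3) (c * p2 * g1) (p2 * g2) (d * p2 * g3)
     ((1 + f) * p3 * g1) (f * p3 * g2) (p3 * g3) s u ->
  locally_max 1 1 b c 1 d (1 + f) f 1 (s * p2) (u * p3 / p2).
Proof.
move=> p20 p30 g10 g20 g30 H w v z.
have [p2n p3n] : p2 != 0 /\ p3 != 0 by rewrite !gt_eqF.
have [r r0 h] := H (w * p3) (v * p2 / p3) (z / p2); exists r => // e /h h'.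
have K0 : 0 < p2 * p3 * g1 * g2 ^+ 3 * g3 by rewrite !mulr_gt0 ?exprn_gt0.
rewrite -(pmulr_rge0 _ K0); move: h'; congr (0 <= _); rewrite /gain; field.
by rewrite ?p2n ?p3n.
Qed.

Lemma escape q11 q12 q13 q21 q22 q23 q31 q32 q33 s u :
  0 < q11 -> 0 < q12 -> 0 < q13 -> 0 < q21 -> 0 < q22 -> 0 < q23 ->
  0 < q31 -> 0 < q32 -> 0 < q33 ->
  let D := q11 * q22 * q33 + q12 * q23 * q31 + q13 * q32 * q21
    - q11 * q23 * q32 - q22 * q13 * q31 - q33 * q12 * q21 in
  let A := q33 * q12 - q32 * q13 in
  0 < D -> 0 < A -> 0 < q31 * q12 - q32 * q11 -> D * q12 <= A * q11 * q22 ->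
  locally_max q11 q12 q13 q21 q22 q23 q31 q32 q33 s u ->
  let r1 := q11 + s * q21 in let r2 := q12 + s * q22 in let r3 := q13 + s * q23 in
  exists2 sg, 0 <= sg &
    let z1 := r1 - sg * q31 in let z2 := r2 - sg * q32 in let z3 := r3 - sg * q33 in
    let C := z2 * (q23 + u * q33) - z3 * (q22 + u * q32) in
    [/\ 0 <= z1, 0 <= z2, 0 <= z3, C <= 0 & D * z3 <= - C * q33 * z1].
Proof.
move=> q11p q12p q13p q21p q22p q23p q31p q32p q33p D A D0 A0 V0 hD H r1 r2 r3.
have [n11 n12 n22] : [/\ q11 != 0, q12 != 0 & q22 != 0] by rewrite !gt_eqF.
pose p2 := q22 / q12; pose V := q31 * q12 - q32 * q11; pose p3 := V / (q11 * q12).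
have Vn : V != 0 by rewrite gt_eqF.
have p20 : 0 < p2 by rewrite divr_gt0.
have p30 : 0 < p3 by rewrite divr_gt0 ?mulr_gt0.
pose g3 := q33 / p3; have g30 : 0 < g3 by rewrite divr_gt0.
have n33 : q33 != 0 by rewrite gt_eqF.
pose c := q21 / (p2 * q11); pose b := q13 / g3; pose d := q23 / (p2 * g3);
  pose f := q32 / (p3 * q12).
have c0 : 0 < c := divr_gt0 q21p (mulr_gt0 p20 q11p).
have b0 : 0 < b := divr_gt0 q13p g30.
have f0 : 0 < f := divr_gt0 q32p (mulr_gt0 p30 q12p).
have [p2n p3n g3n] : [/\ p2 != 0, p3 != 0 & g3 != 0] by rewrite !gt_eqF.
have e13 : q13 = b * g3 by rewrite /b divfK.
have e21 : q21 = c * p2 * q11 by rewrite /c; field; rewrite n11 p2n.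
have e22 : q22 = p2 * q12 by rewrite /p2 divfK.
have e23 : q23 = d * p2 * g3 by rewrite /d; field; rewrite g3n p2n.
have e31 : q31 = (1 + f) * p3 * q11.
  have -> : (1 + f) * p3 * q11 = (p3 * (q11 * q12) + q32 * q11) / q12.
    by rewrite /f; field; rewrite n12 p3n.
  by rewrite /p3 divfK ?mulf_neq0 // /V; field.
have e32 : q32 = f * p3 * q12 by rewrite /f; field; rewrite n12 p3n.
have e33 : q33 = p3 * g3 by rewrite /g3; field.
clearbody c b d f; clearbody g3; clearbody p3; clearbody p2.
have AE : A = p3 * g3 * q12 * (1 - f * b) by rewrite /A e33 e32 e13; ring.
have K0 : 0 < p3 * g3 * q12 by rewrite !mulr_gt0.
have k0 : 0 < 1 - f * b by move: A0; rewrite AE pmulr_rgt0.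
move: H; rewrite e13 e21 e22 e23 e31 e32 e33 => /(locally_max_scale p20 p30 q11p q12p g30) H.
have [sE uE dE] := crit_first c0 f0 k0 H.
rewrite sE uE in H.
have DE : D = q11 * p2 * p3 * g3 * q12 * ((1 - f * b) * (1 - c + c / f)).
  rewrite /D ?e13 ?e21 ?e22 ?e23 ?e31 ?e32 ?e33.
  have -> : d = b + c * (1 - f * b) / f.
    by apply: (mulfI (lt0r_neq0 f0)); rewrite dE; field; rewrite gt_eqF.
  by field; rewrite gt_eqF.
have f1 : 1 <= f.
  move: hD; rewrite DE AE ?e22.
  have -> : q11 * p2 * p3 * g3 * q12 * ((1 - f * b) * (1 - c + c / f)) * q12
     = (q11 * p2 * p3 * g3 * q12 * q12 * (1 - f * b)) * (1 - c + c / f) by ring.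
  have -> : p3 * g3 * q12 * (1 - f * b) * q11 * (p2 * q12)
     = (q11 * p2 * p3 * g3 * q12 * q12 * (1 - f * b)) * 1 by ring.
  rewrite ler_pM2l ?mulr_gt0 // => h.
  have {h} : c / f <= c by lra.
  by rewrite ler_pdivrMr // ler_pMr.
have hg := crit_second c0 f1 k0 dE H.
have [z10 z20 z30 C0 hC] := escape_normalized c0 f1 (ltW b0) k0 dE hg.
exists ((1 + f^-1) / 2 / p3); first by rewrite !divr_ge0 ?(ltW p30) // addr_ge0 // invr_ge0 ltW.
move=> z1 z2 z3 C.
have sE' : s = f / p2 by rewrite -sE mulfK.
have uE' : u = c * p2 / p3 by rewrite -uE; field; rewrite p2n p3n.
have z1E : z1 = q11 * (1 + f * c - (1 + f^-1) / 2 * (1 + f)).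
  by rewrite /z1 /r1 sE' ?e21 ?e31; field; rewrite p2n p3n gt_eqF.
have z2E : z2 = q12 * (1 + f - (1 + f^-1) / 2 * f).
  by rewrite /z2 /r2 sE' ?e22 ?e32; field; rewrite p2n p3n gt_eqF.
have z3E : z3 = g3 * (b + f * d - (1 + f^-1) / 2).
  by rewrite /z3 /r3 sE' ?e13 ?e23 ?e33; field; rewrite p2n p3n gt_eqF.
have CE : C = q12 * p2 * g3 * ((1 + f - (1 + f^-1) / 2 * f) * (d + c) - (b + f * d - (1 +
  f^-1) / 2) * (1 + c * f)).
  by rewrite /C z2E z3E uE' ?e23 ?e33 ?e22 ?e32; field; rewrite p3n gt_eqF.
rewrite z1E z2E z3E CE; split.
- by rewrite mulr_ge0 // ltW.
- by rewrite mulr_ge0 // ltW.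
- by rewrite mulr_ge0 // ltW.
- by rewrite mulr_ge0_le0 // !mulr_ge0 // ltW.
- rewrite DE ?e33.
  have K1 : 0 <= q11 * p2 * p3 * g3 * q12 * g3 by rewrite !mulr_ge0 // ltW.
  have := ler_wpM2l K1 hC; congr (_ <= _); ring.
Qed.

End Escape.

(** * The compact set of decompositions *)

Section Maximum.
Local Open Scope classical_set_scope.
Variable R : realType.
Implicit Types (M N Q Z : 'M[R]_3) (i j l : 'I_3) (s t u w : R) (x : R * R * R).

Definition peel3 i j l M (x : R * R * R) : 'M[R]_3 :=
  addrow j i (- x.2) (addrow i l (- x.1.2) (addrow l j (- x.1.1) M)).

Lemma peel3K i j l M x : frame i j l ->
  M = addrow l j x.1.1 (addrow i l x.1.2 (addrow j i x.2 (peel3 i j l M x))).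
Proof.
move=> F; have nq := frame_neq F.
by rewrite /peel3; do 3!rewrite addrowD ?nq // subrr addrow0.
Qed.

Lemma peel3_l i j l M x b : frame i j l ->
  peel3 i j l M x l b = M l b - x.1.1 * M j b.
Proof.
by move=> F; rewrite /peel3 !(addrowx, addrown) ?(frame_neq F) // mulNr.
Qed.

Lemma peel3_i i j l M x b : frame i j l ->
  peel3 i j l M x i b = M i b - x.1.2 * (M l b - x.1.1 * M j b).
Proof.
by move=> F; rewrite /peel3 !(addrowx, addrown) ?(frame_neq F) // !mulNr.
Qed.

Lemma peel3_j i j l M x b : frame i j l ->
  peel3 i j l M x j b = M j b - x.2 * (M i b - x.1.2 * (M l b - x.1.1 * M j b)).
Proof.
by move=> F; rewrite /peel3 !(addrowx, addrown) ?(frame_neq F) // !mulNr.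
Qed.

Lemma det_peel3 i j l M x : frame i j l -> \det (peel3 i j l M x) = \det M.
Proof. by move=> F; rewrite /peel3 !det_addrow ?(frame_neq F). Qed.

Lemma cont_fst_fst : continuous (fun x : R * R * R => x.1.1).
Proof. by move=> x; apply: (@cvg_comp _ _ _ fst fst _ (nbhs x.1)); exact: cvg_fst. Qed.
Lemma cont_fst_snd : continuous (fun x : R * R * R => x.1.2).
Proof. by move=> x; apply: (@cvg_comp _ _ _ fst snd _ (nbhs x.1));
  [exact: cvg_fst|exact: cvg_snd]. Qed.
Lemma cont_snd : continuous (fun x : R * R * R => x.2).
Proof. by move=> x; exact: cvg_snd. Qed.

Lemma cont_peel3 i j l M a b : frame i j l ->
  continuous (fun x : R * R * R => peel3 i j l M x a b).
Proof.
move=> F.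
have cl b' : continuous (fun x : R * R * R => M l b' - x.1.1 * M j b').
  by move=> x; apply: cvgB; [exact: cvg_cst | apply: cvgMl; exact: cont_fst_fst].
have ci b' : continuous (fun x : R * R * R => M i b' - x.1.2 * (M l b' - x.1.1 * M j b')).
  by move=> x; apply: cvgB; [exact: cvg_cst | apply: cvgM; [exact: cont_fst_snd | exact: cl]].
move: a; apply: (frame_ind F).
- by under eq_fun do rewrite peel3_i //; exact: ci.
- under eq_fun do rewrite peel3_j //.
  by move=> x; apply: cvgB; [exact: cvg_cst | apply: cvgM; [exact: cont_snd | exact: ci]].
- by under eq_fun do rewrite peel3_l //; exact: cl.
Qed.

Lemma cont_cofac i j l M (i' j' l' : 'I_3) : frame i j l ->
  continuous (fun x : R * R * R => cofac i' j' l' (peel3 i j l M x)).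
Proof.
move=> F x; rewrite /cofac; apply: cvgB; apply: cvgM; exact: cont_peel3.
Qed.

(** Only the second alternative of admissibility is imposed, so that near an interior point the
    objective alone decides membership.  For a matrix outside reach2 the first alternative never
    occurs. *)
Definition peelings i j l M : set (R * R * R) := [set x |
  [/\ 0 <= x.1.1, 0 <= x.1.2, 0 <= x.2, forall a b, 0 <= peel3 i j l M x a b &
   cofac i j l (peel3 i j l M x) <= 0 /\
   \det M * peel3 i j l M x j i <=
     - cofac i j l (peel3 i j l M x) * peel3 i j l M x i i * peel3 i j l M x j j]].

Lemma peelings_pos i j l M x : frame i j l -> 0 < \det M -> peelings i j l M x ->
  pos_mx (peel3 i j l M x) /\ admissible i j l (peel3 i j l M x).
Proof.
move=> F dM [_ _ _ Q0 [c1 E]]; split; first by split=> //; rewrite det_peel3.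
by split=> //; right; rewrite det_peel3.
Qed.

Lemma peelings_closed i j l M : frame i j l -> closed (peelings i j l M).
Proof.
move=> F.
have cl (f g : R * R * R -> R) : continuous f -> continuous g -> closed [set x | f x <= g x].
  move=> contf contg; have -> : [set x | f x <= g x] = (g \- f) @^-1` [set y | 0 <= y].
    by apply/seteqP; split=> x /=; rewrite subr_ge0.
  by apply: preimage_closed; [move=> x _; apply: cvgB;
    [exact: contg|exact: contf] | exact: closed_ge].
have c0 : continuous (fun _ : R * R * R => 0 : R) by move=> x; exact: cvg_cst.
have -> : peelings i j l M =
   [set x | 0 <= x.1.1] `&` [set x | 0 <= x.1.2] `&` [set x | 0 <= x.2]
   `&` (\bigcap_(ab in [set: 'I_3 * 'I_3]) [set x | 0 <= peel3 i j l M x ab.1 ab.2])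
   `&` [set x | cofac i j l (peel3 i j l M x) <= 0]
   `&` [set x | \det M * peel3 i j l M x j i <=
     - cofac i j l (peel3 i j l M x) * peel3 i j l M x i i * peel3 i j l M x j j].
  apply/seteqP; split=> x /=.
    by move=> [h1 h2 h3 h4 [h5 h6]]; do !split=> //; move=> [a b] _ /=.
  by move=> [[[[[h1 h2] h3] h4] h5] h6]; split=> //; move=> a b; exact: (h4 (a, b)).
repeat apply: closedI.
- by apply: cl => //; exact: cont_fst_fst.
- by apply: cl => //; exact: cont_fst_snd.
- by apply: cl => //; exact: cont_snd.
- by apply: closed_bigI => ab _; apply: cl => //; exact: cont_peel3.
- by apply: cl => //; exact: cont_cofac.
- apply: cl => x.
    by apply: cvgMr; exact: cont_peel3.
  by apply: cvgM; [apply: cvgM; [apply: cvgN; exact: cont_cofac|]|]; exact: cont_peel3.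
Qed.

(** Entries can only be subtracted while they stay nonnegative.  The diagonal entries by which
    one divides are bounded below because their product is at least the determinant. *)
Lemma peelings_compact i j l M : frame i j l -> 0 < \det M -> (forall a b, 0 <= M a b) ->
  0 < M j j -> compact (peelings i j l M).
Proof.
move=> F dM M0 Mj; have nq := frame_neq F.
(* these bound w, u and s: det M <= Q_ii Q_jj Q_ll bounds Q_ll, resp. Q_ii, from below *)
pose B1 := M l j / M j j; pose B2 := M i l * (M j j * M i i) / \det M.
pose B3 := M j i * (M j j * M l l) / \det M.
apply: (@subclosed_compact _ _ ((`[0, B1] `*` `[0, B2]) `*` `[0, B3])).
- exact: peelings_closed.
- by apply: compact_setX; [apply: compact_setX|]; exact: segment_compact.
move=> x ox; have [pQ w] := peelings_pos F dM ox; have [x1 x2 x3 Q0 _] := ox.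
have g := admissible_goodman F pQ w; rewrite det_peel3 // in g.
have := Q0 l j; rewrite peel3_l // subr_ge0 => h1.
have := Q0 i l; rewrite peel3_i // -(peel3_l M x l F) subr_ge0 => h2.
have := Q0 j i; rewrite peel3_j // -(peel3_i M x i F) subr_ge0 => h3.
have hj : peel3 i j l M x j j <= M j j.
  by rewrite peel3_j // -(peel3_i M x j F) gerBl mulr_ge0.
have hi : peel3 i j l M x i i <= M i i.
  by rewrite peel3_i // -(peel3_l M x i F) gerBl mulr_ge0.
have hl : peel3 i j l M x l l <= M l l.
  by rewrite peel3_l // gerBl mulr_ge0.
split; [split|]; rewrite /= in_itv /= ?x1 ?x2 ?x3 /=.
- by rewrite /B1 ler_pdivlMr.
- rewrite /B2 ler_pdivlMr //.
  apply: (@le_trans _ _ (x.1.2 * peel3 i j l M x l l * (M j j * M i i))).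
    rewrite -mulrA ler_wpM2l //; apply: (le_trans g); rewrite mulrC ler_wpM2l //.
    by rewrite (mulrC (M j j)) ler_pM.
  by rewrite ler_wpM2r ?mulr_ge0 // ltW.
- rewrite /B3 ler_pdivlMr //.
  apply: (@le_trans _ _ (x.2 * peel3 i j l M x i i * (M j j * M l l))).
    rewrite -mulrA ler_wpM2l //; apply: (le_trans g); rewrite -mulrA ler_wpM2l //.
    by rewrite ler_pM.
  by rewrite ler_wpM2r ?mulr_ge0 // ltW.
Qed.

End Maximum.

(** * The one addition that does not commute *)

Section Hard.
Local Open Scope classical_set_scope.
Variable R : realType.
Implicit Types (M N Q Z : 'M[R]_3) (i j l : 'I_3) (s t u w : R) (x : R * R * R).

(** If a parameter or an entry vanishes, or C_il <= 0, then one of the three additions can be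
    dropped or absorbed into an admissible matrix, and M is in reach2. *)
Lemma peelings_interior i j l M x : frame i j l -> pos_mx M -> ~ reach2 M ->
  peelings i j l M x ->
  let Q := peel3 i j l M x in
  [/\ 0 < x.1.1, 0 < x.1.2, 0 < x.2, forall a b, 0 < Q a b & 0 < cofac i l j Q].
Proof.
move=> F [M0 dM] nT ox Q; have nq := frame_neq F.
have [pQ w] := peelings_pos F dM ox; have [x1 x2 x3 Q0 _] := ox.
have ME := peel3K M x F; rewrite -/Q in pQ w Q0 ME.
have pN : pos_mx (addrow j i x.2 Q) by apply: pos_addrow; rewrite ?nq.
have key : ~ admissible_any (addrow j i x.2 Q).
  move=> wN; apply: nT; rewrite ME; apply: reach1_addrow; rewrite ?nq //.
  by apply: any_addrow; rewrite ?nq.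
have pos y : 0 <= y -> (y = 0 -> False) -> 0 < y :> R.
  by move=> y0 yn; rewrite lt_neqAle y0 andbT eq_sym; apply/eqP.
have reach1N : reach1 (addrow j i x.2 Q) by exists i, j, l, x.2, Q.
split.
- apply: pos => // e; apply: nT; rewrite ME e addrow0.
  by exists i, j, l, x.1.2, x.2, Q.
- apply: pos => // e; apply: nT; rewrite ME e addrow0.
  by apply: reach1_addrow; rewrite ?nq.
- apply: pos => // e; apply: key; rewrite e addrow0; by exists i, j, l.
- move=> a b; apply: pos => // e.
  have g := admissible_goodman F pQ w.
  have [Qi Qj Ql] := diag_gt0 pQ g.
  have z (x' y' z' : 'I_3) : frame x' y' z' -> \det Q <= Q x' x' * Q y' y' * Q z' z' ->
    Q x' y' = 0 -> False.
    by move=> F' g' e'; apply: key; apply: (zero_entry_addrow F' pQ e' g'); rewrite ?nq.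
  have e1 : Q a a = 0 -> False by elim/(frame_ind F): a {e} => h; move: Qi Qj Ql;
    rewrite h ltxx.
  have [ab|ab] := eqVneq a b; first by apply: e1; rewrite {2}ab.
  have gE A : A = Q i i * Q j j * Q l l -> \det Q <= A by move=> ->.
  move: a b ab e {e1}; apply: (frame_ind2 F) => e.
  + exact: (z i j l).
  + by apply: (z j i l); [rewrite /frame !nq | apply: gE; ring | ].
  + by apply: (z i l j); [rewrite /frame !nq | apply: gE; ring | ].
  + by apply: (z l i j); [rewrite /frame !nq | apply: gE; ring | ].
  + by apply: (z j l i); [rewrite /frame !nq | apply: gE; ring | ].
  + by apply: (z l j i); [rewrite /frame !nq | apply: gE; ring | ].
- rewrite ltNge; apply/negP => c; apply: key.
  have F' : frame i l j by rewrite /frame !nq.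
  apply: (admissible_addrow F') => //; rewrite ?nq ?xpair_eqE ?negb_and ?nq //.
  by case: w => c1 _; split=> //; left.
Qed.

Definition objective i j l M x : R :=
  let Q := peel3 i j l M x in - cofac i j l Q * Q i i * Q j j.

(** The comparison is cross-multiplied to avoid the quotients - C_ij Q_ii Q_jj / Q_ji. *)
Lemma peelings_max i j l M x0 : frame i j l -> pos_mx M -> ~ reach2 M -> peelings i j l M x0 ->
  exists2 x, peelings i j l M x & forall y, peelings i j l M y ->
    objective i j l M y * peel3 i j l M x j i <= objective i j l M x * peel3 i j l M y j i.
Proof.
move=> F pM nT ox; have [M0 dM] := pM; have nq := frame_neq F.
have Mj : 0 < M j j.
  have [x1 x2 x3 Q0 _] := peelings_interior F pM nT ox.
  by move: (Q0 j j); rewrite peel3_j // -(peel3_i M x0 j F) subr_gt0; apply: le_lt_trans;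
    rewrite mulr_ge0 // ltW.
pose f x := objective i j l M x / peel3 i j l M x j i.
have contf : {within peelings i j l M, continuous f}.
  apply: continuous_in_subspaceT => x /set_mem oxx.
  have [_ _ _ Q0 _] := peelings_interior F pM nT oxx.
  apply: cvgM; last by apply: cvgV; [rewrite gt_eqF // Q0 | exact: cont_peel3].
  by apply: cvgM; [apply: cvgM; [apply: cvgN; exact: cont_cofac|]|]; exact: cont_peel3.
have [x xo xm] := compact_EVT_max (ex_intro _ x0 ox) (peelings_compact F dM M0 Mj) contf.
move/set_mem: xo => xo; exists x => // y yo.
have [_ _ _ Qx _] := peelings_interior F pM nT xo.
have [_ _ _ Qy _] := peelings_interior F pM nT yo.
have := xm y (mem_set yo); rewrite /f ler_pdivrMr ?Qy // mulrAC ler_pdivlMr ?Qx //.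
Qed.

(** Near an interior maximum, parameters violating the determinant inequality cannot beat the
    maximum either, so it is a maximum over a full neighbourhood. *)
Lemma peelings_locally_max i j l M x : frame i j l -> pos_mx M -> ~ reach2 M ->
  peelings i j l M x ->
  (forall y, peelings i j l M y ->
    objective i j l M y * peel3 i j l M x j i <= objective i j l M x * peel3 i j l M y j i) ->
  let Q := peel3 i j l M x in
  locally_max (Q j j) (Q j i) (Q j l) (Q i j) (Q i i) (Q i l) (Q l j) (Q l i) (Q l l) x.2 x.1.2.
Proof.
move=> F pM nT ox xm Q w v z; have [M0 dM] := pM.
have [x1 x2 x3 Q0 c] := peelings_interior F pM nT ox.
have [_ _ _ _ [c1 E]] := ox.
pose y (e : R) : R * R * R := ((x.1.1 + e * w, x.1.2 + e * v), x.2 + e * z).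
have cy : y e @[e --> (0 : R)] --> ((x.1.1, x.1.2), x.2).
  have ce (a b : R) : a + e * b @[e --> (0 : R)] --> a.
    rewrite -[X in _ --> X]addr0 -[X in _ --> _ + X](mul0r b).
    by apply: cvgD; [exact: cvg_cst | apply: cvgMl; exact: cvg_id].
  exact: (cvg_pair (cvg_pair (ce x.1.1 w) (ce x.1.2 v)) (ce x.2 z)).
rewrite -!surjective_pairing in cy.
have near_pos (f : R * R * R -> R) : continuous f -> 0 < f x ->
  \forall e \near (0 : R), 0 < f (y e).
  move=> contf fx; have : f (y e) @[e --> (0 : R)] --> f x by apply: cvg_comp cy (contf x).
  by move/cvgr_gt; apply.
have dlt : cofac i j l (peel3 i j l M x) < 0.
  have p : 0 < \det M * peel3 i j l M x j i by rewrite mulr_gt0.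
  have := lt_le_trans p E; rewrite pmulr_lgt0 // pmulr_lgt0 // oppr_gt0 //.
have : \forall e \near (0 : R), [/\ [/\ 0 < (y e).1.1, 0 < (y e).1.2 & 0 < (y e).2],
    0 < - cofac i j l (peel3 i j l M (y e)) & forall a b, 0 < peel3 i j l M (y e) a b].
  have n1 := near_pos _ (@cont_fst_fst R) x1.
  have n2 := near_pos _ (@cont_fst_snd R) x2.
  have n3 := near_pos _ (@cont_snd R) x3.
  have n4 a b := near_pos _ (@cont_peel3 R i j l M a b F) (Q0 a b).
  have c5 : continuous (fun x => - cofac i j l (peel3 i j l M x)).
    by move=> t; apply: cvgN; exact: cont_cofac.
  have n5 := near_pos _ c5; rewrite oppr_gt0 in n5; have {}n5 := n5 dlt.
  near=> e; split.
  - by split; near: e.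
  - by near: e.
  - suff : forall a, forall b, 0 < peel3 i j l M (y e) a b by [].
    by apply: (frame_ind F); apply: (frame_ind F); near: e; apply: n4.
move/nbhs_ballP => [r /= r0 H]; exists r => // e er.
have {H} [[y1 y2 y3] cy0 Qy] : [/\ [/\ 0 < (y e).1.1, 0 < (y e).1.2 & 0 < (y e).2],
    0 < - cofac i j l (peel3 i j l M (y e)) & forall a b, 0 < peel3 i j l M (y e) a b].
  by apply: H; rewrite /ball /= sub0r normrN.
have key : objective i j l M (y e) * peel3 i j l M x j i
  <= objective i j l M x * peel3 i j l M (y e) j i.
  case: (lerP (\det M * peel3 i j l M (y e) j i) (objective i j l M (y e))) => h.
    apply: xm; split; [exact: ltW | exact: ltW | exact: ltW | by move=> a b;
      exact: ltW | split=> //].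
    by rewrite -oppr_ge0 ltW.
  apply: (@le_trans _ _ (\det M * peel3 i j l M (y e) j i * peel3 i j l M x j i)).
    by rewrite ler_wpM2r // ltW.
  by rewrite mulrAC ler_wpM2r // ltW.
rewrite -subr_ge0 in key; move: key; congr (0 <= _); rewrite /gain /objective -/Q.
have el b : M l b = Q l b + x.1.1 * M j b by rewrite /Q peel3_l //; ring.
have ei b : M i b = Q i b + x.1.2 * Q l b by rewrite /Q peel3_i // (peel3_l _ _ _ F); ring.
have ej b : M j b = Q j b + x.2 * Q i b by rewrite /Q peel3_j // (peel3_i _ _ _ F); ring.
rewrite /cofac !(peel3_l _ _ _ F) !(peel3_i _ _ _ F) !(peel3_j _ _ _ F).
rewrite !el !ei !ej /y /=; ring.
Unshelve. all: by end_near.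
Qed.

Lemma reach2_addrow_next i j l t u s Q : frame i j l -> 0 <= t -> 0 <= u -> 0 <= s ->
  pos_mx Q -> admissible i j l Q -> reach2 (addrow l j t (addrow i l u (addrow j i s Q))).
Proof.
move=> F t0 u0 s0 pQ w; have nq := frame_neq F.
set M := addrow l j _ _; apply: contrapT => nT.
have pM : pos_mx M by rewrite /M; do 3!(apply: pos_addrow; rewrite ?nq //).
have [M0 dM] := pM.
have QE : peel3 i j l M ((t, u), s) = Q.
  by rewrite /peel3 /M /=; do 3!rewrite addrowD ?nq // addNr addrow0.
have ox0 : peelings i j l M ((t, u), s).
  rewrite /peelings /= QE; split=> //; [by case: pQ | case: (w) => c1 h; split=> //].
  have dE : \det M = \det Q by rewrite /M !det_addrow ?nq.
  rewrite dE; case: h => // c2; exfalso; apply: nT.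
  apply: reach1_addrow; rewrite ?nq //; apply: any_addrow; rewrite ?nq //.
    by apply: pos_addrow; rewrite ?nq.
  have F' : frame i l j by rewrite /frame !nq.
  apply: (admissible_addrow F') => //; rewrite ?nq ?xpair_eqE ?negb_and ?nq //.
  by split=> //; left.
have [x ox xm] := peelings_max F pM nT ox0.
have lm := peelings_locally_max F pM nT ox xm.
have [x1 x2 x3 Q0 c] := peelings_interior F pM nT ox.
have [_ _ _ _ [c1 E]] := ox.
have ME := peel3K M x F; move: lm Q0 c c1 E ME => /=.
have dE : \det M = \det (peel3 i j l M x) by rewrite det_peel3.
move: dE; move: (peel3 i j l M x) => Q' dE lm Q0 c c1 E ME.
have Fj : frame j i l by rewrite /frame !nq.
have [||||sg sg0] := @escape R (Q' j j) (Q' j i) (Q' j l) (Q' i j) (Q' i i) (Q' i l) (Q' l j)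
  (Q' l i) (Q' l l)
  x.2 x.1.2 (Q0 _ _) (Q0 _ _) (Q0 _ _) (Q0 _ _) (Q0 _ _) (Q0 _ _) (Q0 _ _) (Q0 _ _) (Q0 _ _) _
    _ _ _ lm.
- by rewrite -(det_frame _ Fj) -dE.
- have p : 0 < \det M * Q' j i by rewrite mulr_gt0.
  have := lt_le_trans p E; rewrite pmulr_lgt0 // pmulr_lgt0 // /cofac opprB.
  by rewrite (mulrC (Q' j i)) (mulrC (Q' j l)).
- by move: c; rewrite /cofac.
- rewrite -(det_frame _ Fj) -dE; apply: (le_trans E); rewrite le_eqVlt; apply/orP; left;
  apply/eqP.
  by rewrite /cofac; ring.
rewrite -(det_frame _ Fj) /=.
set z1 := (_ - sg * Q' l j); set z2 := (_ - sg * Q' l i); set z3 := (_ - sg * Q' l l).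
move=> [z10 z20 z30 C0 hC].
set Ph := addrow i l x.1.2 (addrow j i x.2 Q') in ME.
pose Z := addrow j l (- sg) Ph.
have pPh : pos_mx Ph.
  have pQ' : pos_mx Q' by split; [move=> a b; rewrite ltW | rewrite -dE].
  by rewrite /Ph; do 2!(apply: pos_addrow; rewrite ?nq ?ltW //).
have Zl b : Z l b = Q' l b by rewrite /Z /Ph !(addrowx, addrown) ?nq.
have Zi b : Z i b = Q' i b + x.1.2 * Q' l b by rewrite /Z /Ph !(addrowx, addrown) ?nq.
have Zj b : Z j b = Q' j b + x.2 * Q' i b - sg * Q' l b.
  by rewrite /Z /Ph !(addrowx, addrown) ?nq // mulNr.
have dZ : \det Z = \det Q' by rewrite /Z /Ph !det_addrow ?nq.
have pZ : pos_mx Z.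
  split; last by rewrite dZ -dE.
  apply: (frame_ind F) => b.
  - by rewrite Zi addr_ge0 // ?mulr_ge0 // ltW.
  - by rewrite Zj; elim/(frame_ind F): b.
  - by rewrite Zl ltW.
have Fl : frame l j i by rewrite /frame !nq.
have wZ : admissible l j i Z.
  have cE : cofac l j i Z = z2 * (Q' i l + x.1.2 * Q' l l) - z3 * (Q' i i + x.1.2 * Q' l i).
    by rewrite /cofac !Zi !Zj.
  by split; [rewrite cE | right; rewrite dZ cE Zj Zl Zj].
apply: nT; rewrite ME.
have -> : Ph = addrow j l sg Z by rewrite /Z addrowD ?nq // subrr addrow0.
have [d [s' [t' [d0 s'0 t'0 ->]]]] := addrow_swap Z Fl sg0 (ltW x1).
apply: reach1_reach2; exists l, j, i, s', (scale d (addrow l j t' Z)); split=> //.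
  by apply/pos_scale/pos_addrow; rewrite ?nq.
by apply: admissible_scale => //; apply: admissible_add_ij.
Qed.

End Hard.

(** * Products of elementary stochastic matrices *)

Section Products.
Variable R : realType.
Implicit Types (M N Q Z : 'M[R]_3) (i j l x y : 'I_3) (t u : R).

Lemma reach2_addrow x y t M : x != y -> 0 <= t -> reach2 M -> reach2 (addrow x y t M).
Proof.
move=> xy t0 [i [j [l [u [s [Q [F u0 s0 [pQ w] ->]]]]]]].
have [[-> ->]|ne] := eqVneq (x, y) (l, j); first exact: reach2_addrow_next.
exact: (reach2_addrow_commuting F).
Qed.

Lemma reach2_diagm d : (forall a, 0 < d a) -> reach2 (diagm d : 'M[R]_3).
Proof.
move=> d0; pose l : 'I_3 := lift ord0 ord0.
have F : frame ord0 ord_max l by [].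
apply/reach1_reach2/any_reach1.
  split; first by move=> a b; rewrite mxE; case: eqP => // _; rewrite ltW.
  by rewrite (det_frame _ F) !mxE /= !(mulr0, mul0r, addr0, subr0) !mulr_gt0.
by exists ord0, ord_max, l; split=> //; rewrite /admissible /cofac !mxE /= !(mulr0, mul0r,
  subr0); split; [|left].
Qed.

Lemma rowgen_reach2 n M : rowgen n M -> reach2 M.
Proof.
elim: n M => [|n IH] M /=; first by move=> [d [d0 ->]]; exact: reach2_diagm.
by move=> [x [y [t [N [xy t0 /IH h ->]]]]]; apply: reach2_addrow.
Qed.

Lemma rowgen_scale n M d : (forall a, 0 < d a) -> rowgen n M -> rowgen n (scale d M).
Proof.
move=> d0; elim: n M => [|n IH] M /=.
  move=> [e [e0 ->]]; exists (fun a => d a * e a); split; first by move=> a; rewrite mulr_gt0.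
  by apply/matrixP => a b; rewrite !mxE; case: eqP; rewrite ?mulr0.
move=> [x [y [t [N [xy t0 /IH h ->]]]]]; rewrite addrow_scale //.
by exists x, y, (t * d x / d y), (scale d N); split=> //; rewrite divr_ge0 ?mulr_ge0 // ltW.
Qed.

Lemma elementaryE i j t M a b : i != j ->
  (elementary_mx i j t *m M) a b = if a == i then (1 - t) * M i b + t * M j b else M a b.
Proof.
move=> ij; have [l F] := frame_ex ij; have nq := frame_neq F.
have n1 : (i == j) = false by apply: negbTE; rewrite nq.
have n2 : (j == i) = false by apply: negbTE; rewrite nq.
have n3 : (l == i) = false by apply: negbTE; rewrite nq.
have n4 : (l == j) = false by apply: negbTE; rewrite nq.
have n5 : (i == l) = false by apply: negbTE; rewrite nq.
have n6 : (j == l) = false by apply: negbTE; rewrite nq.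
rewrite mxE (sum_frame _ F) /elementary_mx; elim/(frame_ind F): a;
  rewrite !mxE ?(eqxx, n1, n2, n3, n4, n5, n6) /=; ring.
Qed.

Lemma is_elementary_sum1 (A : 'M[R]_3) : is_elementary A -> forall i, \sum_j A i j = 1.
Proof.
move=> [i [j [t [ij _ _ ->]]]] a.
pose J : 'M[R]_3 := const_mx 1; have JE b c : J b c = 1 by rewrite mxE.
have <- : (elementary_mx i j t *m J) a ord0 = \sum_c (elementary_mx i j t : 'M[R]_3) a c.
  by rewrite mxE; apply: eq_bigr => c _; rewrite JE mulr1.
by rewrite elementaryE // !JE; case: ifP => _ //; ring.
Qed.

Lemma row_sum_mul M N : (forall i, \sum_j M i j = 1) -> (forall i, \sum_j N i j = 1) ->
  forall i, \sum_j (M *m N) i j = 1.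
Proof.
move=> hM hN i; under eq_bigr do rewrite mxE.
rewrite exchange_big /=; under eq_bigr do rewrite -mulr_sumr hN mulr1.
exact: hM.
Qed.

Lemma prod_sum1 (s : seq 'M[R]_3) : (forall A, A \in s -> is_elementary A) ->
  forall i, \sum_j (\prod_(A <- s) A) i j = 1.
Proof.
elim: s => [_ i|A s IH h].
  rewrite big_nil (bigD1 i) //= mxE eqxx big1 ?addr0 // => j ji.
  by rewrite mxE eq_sym (negbTE ji).
rewrite big_cons; apply: row_sum_mul.
  by apply: is_elementary_sum1; apply: h; rewrite mem_head.
by apply: IH => B Bs; apply: h; rewrite in_cons Bs orbT.
Qed.

(** Moving the row scalings to the left turns each addition into an elementary stochastic
    matrix. *)
Lemma rowgen_prod n M : rowgen n M -> exists s d, [/\ size s = n,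
  forall A, A \in s -> is_elementary A, forall a, 0 < d a & M = scale d (\prod_(A <- s) A)].
Proof.
elim: n M => [|n IH] M /=.
  move=> [d [d0 ->]]; exists [::], d; split=> //.
  by rewrite big_nil; apply/matrixP=> a b; rewrite !mxE; case: eqP; rewrite ?mulr1 ?mulr0.
move=> [x [y [t [N [xy t0 /IH [s [d [<- hs d0 ->]]] ->]]]]].
have p : 0 < d x + t * d y by rewrite ltr_wpDr ?mulr_ge0 // ltW.
exists (elementary_mx x y (t * d y / (d x + t * d y)) :: s),
  (fun a => if a == x then d x + t * d y else d a); split=> //.
- move=> A; rewrite in_cons => /orP[/eqP->|]; last exact: hs.
  exists x, y, (t * d y / (d x + t * d y)); split=> //.
    by rewrite divr_ge0 ?mulr_ge0 // ltW.
  by rewrite ltr_pdivrMr // mul1r ltrDr.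
- by move=> a; case: ifP.
- apply/matrixP=> a b; rewrite big_cons -mulmxE mxE [RHS]mxE elementaryE // !mxE.
  by case: eqP => _ //; field; rewrite gt_eqF.
Qed.

Lemma prod_rowgen (s : seq 'M[R]_3) : (forall A, A \in s -> is_elementary A) ->
  rowgen (size s) (\prod_(A <- s) A).
Proof.
elim: s => [_|A s IH h].
  by rewrite big_nil; exists (fun=> 1); split=> //; apply/matrixP=> a b; rewrite !mxE;
    case: eqP.
have [x [y [t [xy t0 t1 AE]]]] := h A (mem_head _ _).
rewrite big_cons -mulmxE AE.
have -> : elementary_mx x y t *m \prod_(B <- s) B
  = addrow x y t (scale (fun a => if a == x then 1 - t else 1) (\prod_(B <- s) B)).
  apply/matrixP=> a b; rewrite elementaryE // !mxE eqxx (eq_sym y x) (negbTE xy) !mul1r.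
  by case: eqP; rewrite ?mul1r.
apply: rowgen_add => //; apply: rowgen_scale.
  by move=> a; case: ifP; rewrite ?subr_gt0.
by apply: IH => B Bs; apply: h; rewrite in_cons Bs orbT.
Qed.

Lemma prod_seven (s : seq 'M[R]_3) : (forall A, A \in s -> is_elementary A) ->
  exists s', [/\ size s' = 7, forall A, A \in s' -> is_elementary A &
    \prod_(A <- s) A = \prod_(A <- s') A].
Proof.
move=> hs; have [s' [d [s7 hs' d0 E]]] := rowgen_prod (reach2_rowgen (rowgen_reach2
  (prod_rowgen hs))).
exists s'; split=> //; rewrite E; apply/matrixP=> a b; rewrite mxE.
suff -> : d a = 1 by rewrite mul1r.
have := prod_sum1 hs a; rewrite E.
have -> : \sum_j (scale d (\prod_(A <- s') A)) a j = d a * \sum_j (\prod_(A <- s') A) a j.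
  by rewrite mulr_sumr; apply: eq_bigr => j _; rewrite mxE.
by rewrite prod_sum1 // mulr1.
Qed.

End Products.

(** * Limits of products with determinant bounded below *)

Section Closure.
Local Open Scope classical_set_scope.
Variable R : realType.
Implicit Types (M N P : 'M[R]_3) (t u : R).

Lemma det_elementary_mx i j t : i != j -> \det (elementary_mx i j t : 'M[R]_3) = 1 - t.
Proof.
move=> ij; have [l F] := frame_ex ij; have nq := frame_neq F.
have /and3P[n1 n2 n3] := F; rewrite (det_frame _ F) !mxE !eqxx.
rewrite !(eq_sym j i) !(eq_sym l i) !(eq_sym l j) (negbTE n1) (negbTE n2) (negbTE n3) /=.
by ring.
Qed.

Lemma det_elementary (A : 'M[R]_3) : is_elementary A -> 0 < \det A <= 1.
Proof.
move=> [i [j [t [ij t0 t1 ->]]]].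
by rewrite det_elementary_mx // subr_gt0 t1 gerBl.
Qed.

Lemma det_prod_elementary (s : seq 'M[R]_3) : (forall A, A \in s -> is_elementary A) ->
  0 < \det (\prod_(A <- s) A) <= 1 /\
  forall A, A \in s -> \det (\prod_(A <- s) A) <= \det A.
Proof.
elim: s => [_|A s IH h]; first by rewrite big_nil det1 ltr01 lexx.
have /andP[A0 A1] := det_elementary (h A (mem_head _ _)).
have [B Bs|/andP[s0 s1] hs] := IH; first by apply: h; rewrite in_cons Bs orbT.
rewrite big_cons -mulmxE det_mulmx; split.
  by rewrite mulr_gt0 //= mulr_ile1 // ltW.
move=> B; rewrite in_cons => /orP[/eqP->|/hs le]; first by rewrite ler_piMr // ltW.
by apply: le_trans le; rewrite ler_piMl // ltW.
Qed.

Definition word n (ps : 'I_n -> 'I_3 * 'I_3) (r : seq 'I_n) (v : 'I_n -> R) : 'M[R]_3 :=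
  \prod_(k <- r) elementary_mx (ps k).1 (ps k).2 (v k).

Lemma cont_word (T : topologicalType) n (ps : 'I_n -> 'I_3 * 'I_3) (r : seq 'I_n)
    (c : 'I_n -> T -> R) a b :
  (forall k, (ps k).1 != (ps k).2) -> (forall k, continuous (c k)) ->
  continuous (fun x => word ps r (c^~ x) a b).
Proof.
move=> hp hc; elim: r a b => [|k r IH] a b.
  have -> : (fun x => word ps [::] (c^~ x) a b) = (fun=> 1%:M a b).
    by apply/funext=> v; rewrite /word big_nil.
  exact: cst_continuous.
have -> : (fun x => word ps (k :: r) (c^~ x) a b) = (fun x => if a == (ps k).1 then
    (1 - c k x) * word ps r (c^~ x) (ps k).1 b + c k x * word ps r (c^~ x) (ps k).2 b
    else word ps r (c^~ x) a b).
  by apply/funext=> v; rewrite /word big_cons -mulmxE elementaryE.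
case: eqP => _; last exact: IH.
move=> x; apply: cvgD; apply: cvgM; try exact: IH; try exact: hc.
by apply: cvgB; [exact: cvg_cst | exact: hc].
Qed.

Lemma cont_sum (T : topologicalType) (I : Type) (r : seq I) (F : I -> T -> R) :
  (forall i, continuous (F i)) -> continuous (fun v => \sum_(i <- r) F i v).
Proof.
move=> h; elim: r => [|i r IH].
  have -> : (fun v => \sum_(i <- [::]) F i v) = (fun=> 0) by apply/funext=> v; rewrite big_nil.
  by move=> v; exact: cvg_cst.
have -> : (fun v => \sum_(k <- i :: r) F k v) = (fun v => F i v + \sum_(k <- r) F k v).
  by apply/funext=> v; rewrite big_cons.
by move=> v; apply: cvgD; [exact: h | exact: IH].
Qed.

Lemma cont_dist (T : topologicalType) n P (ps : 'I_n -> 'I_3 * 'I_3) (r : seq 'I_n)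
    (c : 'I_n -> T -> R) :
  (forall k, (ps k).1 != (ps k).2) -> (forall k, continuous (c k)) ->
  continuous (fun x => \sum_(a : 'I_3) \sum_(b : 'I_3) `|P a b - word ps r (c^~ x) a b|).
Proof.
move=> hp hc; apply: cont_sum => a; apply: cont_sum => b x.
by apply: cvg_norm; apply: cvgB; [exact: cvg_cst | exact: cont_word].
Qed.

Lemma word_of_prod n (s : seq 'M[R]_3) (dl : R) : size s = n ->
  (forall A, A \in s -> is_elementary A) -> dl <= \det (\prod_(A <- s) A) ->
  exists (ps : {ffun 'I_n -> 'I_3 * 'I_3}) (v : 'rV[R]_n),
  [/\ forall k, (ps k).1 != (ps k).2, forall k, 0 <= v ord0 k <= 1 - dl &
    \prod_(A <- s) A = word ps (index_enum 'I_n) (v ord0)].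
Proof.
move=> sn hs hd; have [_ hdet] := det_prod_elementary hs.
have H (k : 'I_n) : exists q : ('I_3 * 'I_3) * R, [/\ q.1.1 != q.1.2, 0 <= q.2 <= 1 - dl &
    nth 0 s k = elementary_mx q.1.1 q.1.2 q.2].
  have ks : nth 0 s k \in s by rewrite mem_nth // sn.
  have [i [j [t [ij t0 t1 e]]]] := hs _ ks; exists ((i, j), t); split=> //=.
  rewrite t0 /= lerBrDl addrC -lerBrDl; apply: (le_trans hd); apply: le_trans (hdet _ ks) _.
  by rewrite e det_elementary_mx //; lra.
have [f hf] := choice H.
exists [ffun k => (f k).1], (\row_k (f k).2); split.
- by move=> k; rewrite ffunE; case: (hf k).
- by move=> k; rewrite mxE; case: (hf k).
- rewrite /word (big_nth 0) sn big_mkord; apply: eq_bigr => k _.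
  by rewrite ffunE mxE; case: (hf k).
Qed.

(** Each factor has determinant at least dl, so its parameter is at most 1 - dl.  For each of
    the finitely many patterns of index pairs the distance from P to a word attains its minimum
    on the box [0, 1 - dl]^7; the smallest of these minima is 0. *)
Lemma closure_seven P (dl : R) : 0 < dl ->
  (forall e, 0 < e -> exists s : seq 'M[R]_3, [/\ forall A, A \in s -> is_elementary A,
     dl <= \det (\prod_(A <- s) A) & forall a b, `|P a b - (\prod_(A <- s) A) a b| <= e]) ->
  exists s : seq 'M[R]_3, [/\ size s = 7, forall A, A \in s -> is_elementary A &
     P = \prod_(A <- s) A].
Proof.
move=> dl0 H.
have {}H (e : R) : 0 < e -> exists (ps : {ffun 'I_7 -> 'I_3 * 'I_3}) (v : 'rV[R]_7),
  [/\ forall k, (ps k).1 != (ps k).2, forall k, 0 <= v ord0 k <= 1 - dl &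
    forall a b, `|P a b - word ps (index_enum 'I_7) (v ord0) a b| <= e].
  move=> /H [s [hs hd hc]]; have [s' [s7 hs' E]] := prod_seven hs.
  rewrite E in hd hc; have [ps [v [h1 h2 h3]]] := word_of_prod s7 hs' hd.
  by exists ps, v; split=> // a b; rewrite -h3.
pose Bx := [set v : 'rV[R]_7 | forall k, `[0, 1 - dl]%classic (v ord0 k)].
have Bc : compact Bx.
  by apply: (@rV_compact R 7 (fun=> `[0, 1 - dl]%classic)) => k; exact: segment_compact.
pose h (ps : {ffun 'I_7 -> 'I_3 * 'I_3}) (v : 'rV[R]_7) : R :=
  \sum_(a : 'I_3) \sum_(b : 'I_3) `|P a b - word ps (index_enum 'I_7) (v ord0) a b|.
have hcont (ps : {ffun 'I_7 -> 'I_3 * 'I_3}) : (forall k, (ps k).1 != (ps k).2) ->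
  continuous (h ps).
  move=> hp; apply: (@cont_dist 'rV[R]_7 7 P ps (index_enum 'I_7) (fun k v => v ord0 k) hp).
  by move=> k; exact: coord_continuous.
have hge0 ps v : 0 <= h ps v by rewrite sumr_ge0 // => a _; rewrite sumr_ge0.
have [ps0 [v0 [hp0 hv0 _]]] := H 1 ltr01.
have B0 : Bx !=set0 by exists v0 => k /=; rewrite in_itv /= hv0.
have M (ps : {ffun 'I_7 -> 'I_3 * 'I_3}) : exists v, (forall k, (ps k).1 != (ps k).2) ->
    Bx v /\ forall w, Bx w -> h ps v <= h ps w.
  have [hp|hp] := pselect (forall k, (ps k).1 != (ps k).2); last by exists v0 => /hp.
  have [v vB hv] := compact_EVT_min B0 Bc (continuous_subspaceT (hcont ps hp)).
  by exists v => _; split=> [|w wB]; [exact/set_mem | apply: hv; exact/mem_set].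
have [vm hm] := choice M.
pose good (ps : {ffun 'I_7 -> 'I_3 * 'I_3}) := [forall k, (ps k).1 != (ps k).2].
have g0 : good ps0 by apply/forallP.
case: (@Order.TotalTheory.arg_minP _ R _ ps0 good (fun ps => h ps (vm ps)) g0) => ps gps hps.
have hp k : (ps k).1 != (ps k).2 by move/forallP: gps.
have [vB vmin] := hm ps hp.
have z : h ps (vm ps) = 0.
  apply/le_anti; rewrite hge0 andbT leNgt; apply/negP => p.
  have [q [w [hq hw hc]]] := H (h ps (vm ps) / 10) (divr_gt0 p (ltr0n _ 10)).
  have gq : good q by apply/forallP.
  have [_ qmin] := hm q hq.
  have c1 := hps q gq; have c2 : h q (vm q) <= h q w by apply: qmin => k /=;
    rewrite in_itv /= hw.
  have c3 : h q w <= \sum_(a : 'I_3) \sum_(b : 'I_3) (h ps (vm ps) / 10).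
    by apply: ler_sum => a _; apply: ler_sum => b _.
  have : h ps (vm ps) <= \sum_(a : 'I_3) \sum_(b : 'I_3) (h ps (vm ps) / 10).
    exact: le_trans c1 (le_trans c2 c3).
  by rewrite !big_ord_recl !big_ord0; lra.
exists [seq elementary_mx (ps k).1 (ps k).2 (vm ps ord0 k) | k <- index_enum 'I_7]; split.
- by rewrite size_map -sum1_size big_const_ord.
- move=> A /mapP[k _ ->]; exists (ps k).1, (ps k).2, (vm ps ord0 k).
  have := vB k; rewrite /= in_itv /= => /andP[k0 k1]; split=> //.
  by apply: le_lt_trans k1 _; rewrite ltrBlDr ltrDl.
- rewrite big_map -/(word ps _ _); apply/matrixP => a b; apply/eqP.
  rewrite -subr_eq0 -normr_eq0; apply/eqP.
  move/eqP: z; rewrite psumr_eq0; last by move=> a' _; rewrite sumr_ge0.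
  move=> /allP/(_ a (mem_index_enum a)) /=; rewrite psumr_eq0 //.
  by move=> /allP/(_ b (mem_index_enum b)) /eqP.
Qed.

End Closure.

(** * Stochastic matrices near the identity *)

Section Approximation.
Variable R : realType.
Implicit Types (A B M N D S : 'M[R]_3) (c d t u e : R).

Definition row_norm_le D c := forall a, \sum_b `|D a b| <= c.

Lemma row_normD D D' c c' : row_norm_le D c -> row_norm_le D' c' ->
  row_norm_le (D + D') (c + c').
Proof.
move=> h h' a; apply: le_trans (lerD (h a) (h' a)); rewrite -big_split /=.
by apply: ler_sum => b _; rewrite mxE ler_normD.
Qed.

Lemma row_normM D S c d : 0 <= d -> row_norm_le D c -> row_norm_le S d ->
  row_norm_le (D *m S) (c * d).
Proof.
move=> d0 h h' a; apply: (@le_trans _ _ (\sum_k `|D a k| * d)); last first.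
  by rewrite -mulr_suml ler_wpM2r.
apply: (@le_trans _ _ (\sum_b \sum_k `|D a k| * `|S k b|)).
  apply: ler_sum => b _; rewrite mxE; apply: le_trans (ler_norm_sum _ _ _) _.
  by apply: ler_sum => k _; rewrite normrM.
rewrite exchange_big /=; apply: ler_sum => k _.
by rewrite -mulr_sumr ler_wpM2l.
Qed.

Lemma row_norm_stochastic A : row_stochastic A -> row_norm_le A 1.
Proof.
move=> [A0 A1] a; rewrite -(A1 a); apply: ler_sum => b _; rewrite ger0_norm //.
Qed.

Lemma stochastic1 : row_stochastic (1%:M : 'M[R]_3).
Proof.
split; first by move=> a b; rewrite mxE; case: (a == b).
by have h := @prod_sum1 R [::]; rewrite big_nil in h; apply: h.
Qed.

Lemma stochasticM A B : row_stochastic A -> row_stochastic B -> row_stochastic (A *m B).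
Proof.
move=> [A0 A1] [B0 B1]; split; last exact: row_sum_mul.
by move=> a b; rewrite mxE sumr_ge0 // => k _; rewrite mulr_ge0.
Qed.

Lemma stochastic_elementary A : is_elementary A -> row_stochastic A.
Proof.
move=> h; split; last exact: is_elementary_sum1.
have [i [j [t [ij t0 t1 ->]]]] := h => a b; rewrite /elementary_mx !mxE.
have [->|ne] := eqVneq a i; last by rewrite ?(negbTE ne) /= subrr mulr0 addr0; case: eqP.
rewrite /=; have [<-|nb] := eqVneq i b.
  rewrite (negbTE ij) sub0r mulrN1 subr_ge0 ltW //.
by rewrite add0r subr0; case: eqP; rewrite ?mulr1 ?mulr0.
Qed.

Lemma stochastic_prod (I : eqType) (s : seq I) (F : I -> 'M[R]_3) :
  (forall x, x \in s -> row_stochastic (F x)) -> row_stochastic (\prod_(x <- s) F x).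
Proof.
elim: s => [_|x s IH h]; first by rewrite big_nil; exact: stochastic1.
rewrite big_cons -mulmxE; apply: stochasticM; first by apply: h; rewrite mem_head.
by apply: IH => y ys; apply: h; rewrite in_cons ys orbT.
Qed.

Definition generator (q : 'I_3 * 'I_3) t : 'M[R]_3 :=
  t *: (delta_mx q.1 q.2 - delta_mx q.1 q.1).

Lemma row_norm_generator q t : 0 <= t -> row_norm_le (generator q t) (2 * t).
Proof.
move=> t0 a.
apply: (@le_trans _ _ (\sum_b (t * (b == q.2)%:R + t * (b == q.1)%:R))).
  apply: ler_sum => b _; rewrite !mxE normrM ger0_norm // -mulrDr ler_wpM2l //.
  by case: (a == q.1); case: (b == q.2); case: (b == q.1);
    rewrite /= ?subrr ?subr0 ?sub0r ?normrN ?normr1 ?normr0 ?addr0 ?add0r ?addr_ge0.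
have S x : \sum_(b : 'I_3) t * (b == x)%:R = t.
  by rewrite (bigD1 x) //= eqxx mulr1 big1 ?addr0 // => b /negbTE ->; rewrite mulr0.
by rewrite big_split /= !S; lra.
Qed.

(** The terms neglected when one more factor is multiplied in are products of two parameters,
    so the total error is quadratic in their sum. *)
Lemma word_expansion (s : seq ('I_3 * 'I_3)) (f : 'I_3 * 'I_3 -> R) :
  (forall q, q \in s -> q.1 != q.2 /\ 0 <= f q < 1) ->
  let M := \prod_(q <- s) elementary_mx q.1 q.2 (f q) in
  let sg := \sum_(q <- s) f q in
  [/\ row_norm_le (M - 1%:M - \sum_(q <- s) generator q (f q)) (4 * sg ^+ 2),
    row_norm_le (M - 1%:M) (2 * sg),
    0 <= sg, row_stochastic M & 1 - sg <= \det M].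
Proof.
elim: s => [_|q s IH h] /=.
  rewrite !big_nil subrr subr0 expr0n mulr0 mulr0 det1 subr0.
  have z : row_norm_le 0 0 by move=> a; under eq_bigr do rewrite mxE normr0; rewrite big1.
  by split=> //; exact: stochastic1.
have [q' q's|] := IH; first by apply: h; rewrite in_cons q's orbT.
rewrite !big_cons; set M := \prod_(_ <- s) _; set S := \sum_(_ <- s) generator _ _.
set sg := \sum_(_ <- s) _; set t := f q => h1 h2 h3 h4 h5.
have [ne /andP[t0 t1]] := h q (mem_head _ _); rewrite -/t in t0 t1.
have el : is_elementary (elementary_mx q.1 q.2 t) by exists q.1, q.2, t.
have KE : elementary_mx q.1 q.2 t = 1%:M + generator q t by [].
have gM : row_norm_le (generator q t *m M) (2 * t).
  by rewrite -[2 * t]mulr1; apply: row_normM => //;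
    [exact: row_norm_generator | exact: row_norm_stochastic].
split.
- have -> : elementary_mx q.1 q.2 t * M - 1%:M - (generator q t + S)
    = (M - 1%:M - S) + generator q t *m (M - 1%:M).
    rewrite -mulmxE KE mulmxDl mul1mx mulmxBr mulmx1.
    move: (generator q t *m M) (generator q t) => X Y; move: (M) (S) => M' S'.
    by apply/matrixP => x y; rewrite !mxE; ring.
  have := row_normD h1 (row_normM (mulr_ge0 (ler0n _ 2) h3) (row_norm_generator q t0) h2).
  have le : 4 * sg ^+ 2 + 2 * t * (2 * sg) <= 4 * (t + sg) ^+ 2.
    by have := sqr_ge0 t; have := mulr_ge0 t0 h3; lra.
  by move=> h' a; exact: le_trans (h' a) le.
- have -> : elementary_mx q.1 q.2 t * M - 1%:M = generator q t *m M + (M - 1%:M).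
    by rewrite -mulmxE KE mulmxDl mul1mx addrCA addrA.
  by rewrite mulrDr; exact: row_normD.
- by rewrite addr_ge0.
- by rewrite -mulmxE; apply: stochasticM => //; exact: stochastic_elementary.
- rewrite -mulmxE det_mulmx.
  rewrite det_elementary_mx //.
  apply: (@le_trans _ _ ((1 - t) * (1 - sg))); first by have := mulr_ge0 t0 h3; lra.
  by rewrite ler_wpM2l // subr_ge0 ltW.
Qed.

Definition o0 : 'I_3 := ord0.
Definition o1 : 'I_3 := lift ord0 ord0.
Definition o2 : 'I_3 := ord_max.
Definition pairs : seq ('I_3 * 'I_3) :=
  [:: (o0, o1); (o0, o2); (o1, o0); (o1, o2); (o2, o0); (o2, o1)].

Lemma F012 : frame o0 o1 o2. Proof. by []. Qed.

Definition defect A := (1 - A o0 o0) + (1 - A o1 o1) + (1 - A o2 o2).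

(** The off-diagonal entries of A serve as parameters, in any order: to first order elementary
    matrices commute. *)
Definition approx A : seq 'M[R]_3 := [seq elementary_mx q.1 q.2 (A q.1 q.2) | q <- pairs].

Lemma approxP A : row_stochastic A -> (forall a, 2/3 <= A a a) ->
  [/\ forall B, B \in approx A -> is_elementary B,
     row_norm_le (A - \prod_(B <- approx A) B) (4 * defect A ^+ 2) &
     1 - defect A <= \det (\prod_(B <- approx A) B)].
Proof.
move=> [A0 A1] Ad.
have off q : q \in pairs -> q.1 != q.2 /\ 0 <= A q.1 q.2 < 1.
  move=> qp; have ne : q.1 != q.2 by move: qp;
    rewrite !inE => /or4P[/eqP->|/eqP->|/eqP->|/or3P[]/eqP->].
  split=> //; rewrite A0 /=; have := A1 q.1; have [l F] := frame_ex ne.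
  by rewrite (sum_frame _ F); have := Ad q.1; have := A0 q.1 l; lra.
have [h1 _ _ _ h5] := word_expansion off.
have s1 a : A a o0 + A a o1 + A a o2 = 1 by rewrite -(A1 a) (sum_frame _ F012).
have dE : \sum_(q <- pairs) A q.1 q.2 = defect A.
  rewrite /pairs !big_cons big_nil /= /defect.
  by have := s1 o0; have := s1 o1; have := s1 o2; rewrite /=; lra.
split.
- by move=> B /mapP[q /off [ne /andP[a0 a1]] ->]; exists q.1, q.2, (A q.1 q.2).
- move=> a; rewrite big_map -dE; apply: le_trans (h1 a).
  apply: ler_sum => b _; rewrite -normrN le_eqVlt; apply/orP; left; apply/eqP; congr (`|_|).
  set X := \prod_(_ <- _) _; set S := \sum_(_ <- _) _.
  suff AE : A = 1%:M + S.
    have := congr1 (fun M : 'M[R]_3 => M a b) AE; move: (X) (S) => X' S'.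
    by rewrite !mxE => ->; ring.
  apply/matrixP => x y; rewrite /S /pairs !big_cons big_nil /generator !mxE.
  have := s1 o0; have := s1 o1; have := s1 o2.
  elim/(frame_ind F012): x; elim/(frame_ind F012): y => /=; lra.
- by rewrite big_map -dE.
Qed.

(** The upper bound lets the determinant control the off-diagonal mass, with constants that are
    not optimal. *)
Lemma det_defect A : row_stochastic A -> (forall a, 5/6 <= A a a) ->
  0 < \det A <= 1 - defect A / 2.
Proof.
move=> [A0 A1] Ad.
have s1 a : A a o0 + A a o1 + A a o2 = 1 by rewrite -(A1 a) (sum_frame _ F012).
rewrite (det_frame _ F012) /defect.
have := s1 o0; have := s1 o1; have := s1 o2; have := Ad o0; have := Ad o1; have := Ad o2.
have := A0 o0 o1; have := A0 o0 o2; have := A0 o1 o0; have := A0 o1 o2; have := A0 o2 o0;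
  have := A0 o2 o1.
move: (A o0 o0) (A o0 o1) (A o0 o2) (A o1 o0) (A o1 o1) (A o1 o2) (A o2 o0) (A o2 o1) (A o2 o2).
move=> a b c d e f g h i h0 g0 f0 d0 c0 b0 i1 e1 a1 s3 s2 s4.
pose x := b + c; pose y := d + f; pose z := g + h.
have -> : a = 1 - x by rewrite /x; lra.
have -> : e = 1 - y by rewrite /y; lra.
have -> : i = 1 - z by rewrite /z; lra.
have [x0 x1] : 0 <= x /\ x <= 1/6 by rewrite /x; split; lra.
have [y0 y1] : 0 <= y /\ y <= 1/6 by rewrite /y; split; lra.
have [z0 z1] : 0 <= z /\ z <= 1/6 by rewrite /z; split; lra.
have le2 (u v : R) : 0 <= u -> 0 <= v -> v <= 1/6 -> 0 <= u * v <= u / 6.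
  by move=> u0 v0 v1; rewrite mulr_ge0 //= ler_wpM2l //; lra.
have /andP[xy0 xy1] := le2 x y x0 y0 y1.
have /andP[yz0 yz1] := le2 y z y0 z0 z1.
have /andP[zx0 zx1] := le2 z x z0 x0 x1.
have xyz : 0 <= x * y * z by rewrite !mulr_ge0.
have t1 : b * f * g + c * h * d <= x * y * z.
  rewrite /x /y /z -subr_ge0.
  have -> : (b + c) * (d + f) * (g + h) - (b * f * g + c * h * d)
    = b * d * g + b * d * h + b * f * h + c * d * g + c * f * g + c * f * h by ring.
  by rewrite !addr_ge0 // !mulr_ge0.
have t0 : 0 <= b * f * g + c * h * d by rewrite addr_ge0 // !mulr_ge0.
have small (w u v : R) p q : 0 <= w <= 1/6 -> 0 <= p <= u -> 0 <= q <= v ->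
  0 <= (1 - w) * p * q <= u * v.
  move=> /andP[w0 w1] /andP[p0 p1] /andP[q0 q1]; rewrite -mulrA !mulr_ge0 //=; last by lra.
  have pq : p * q <= u * v by rewrite ler_pM.
  by apply: le_trans pq; rewrite ler_piMl ?mulr_ge0 //; lra.
have /andP[m10 m11] : 0 <= (1 - x) * f * h <= y * z by apply: small;
  rewrite ?x0 ?f0 ?h0 /y /z //=; lra.
have /andP[m20 m21] : 0 <= (1 - y) * c * g <= x * z by apply: small;
  rewrite ?y0 ?c0 ?g0 /x /z //=; lra.
have /andP[m30 m31] : 0 <= (1 - z) * b * d <= x * y by apply: small;
  rewrite ?z0 ?b0 ?d0 /x /y //=; lra.
have p1 : (1 - x) * (1 - y) * (1 - z) = 1 - x - y - z + (x * y + y * z + z * x) - x * y * z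
  by ring.
have xyz1 : x * y * z <= x / 6 by rewrite -mulrA; apply: ler_wpM2l => //; lra.
rewrite p1 (mulrC x z) in m21 *.
apply/andP; split; lra.
Qed.

End Approximation.

(** * Attainable matrices *)

Section Process.
Local Open Scope classical_set_scope.
Variable R : realType.
Implicit Types (A B M N D S : 'M[R]_3) (c d t u e : R).

Definition near_identity e A := row_stochastic A /\ forall a, 1 - e <= A a a.

Definition approx_seq (L : seq 'M[R]_3) := flatten [seq approx A | A <- L].

(** The determinant of P controls the sum of the defects because
    prod (1 - x) <= 1 / (1 + sum x), and it bounds the determinant of Q from below because
    1 - x >= (1 - x / 2)^4 for 0 <= x <= 1/2. *)
Lemma approx_seqP (L : seq 'M[R]_3) : (forall A, A \in L -> near_identity (1/6) A) ->
  let P := \prod_(A <- L) A in let Q := \prod_(B <- approx_seq L) B in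
  [/\ forall B, B \in approx_seq L -> is_elementary B,
    row_norm_le (P - Q) (\sum_(A <- L) 4 * defect A ^+ 2),
    [/\ row_stochastic P, 0 <= \sum_(A <- L) defect A & 0 < \det P],
    \det P * (1 + (\sum_(A <- L) defect A) / 2) <= 1 & \det P ^+ 4 <= \det Q].
Proof.
elim: L => [_|A L IH h] /=.
  rewrite /approx_seq /= !big_nil subrr det1 expr1n mul0r addr0 mulr1; split=> //; last first.
    by split=> //; exact: stochastic1.
  by move=> a; under eq_bigr do rewrite mxE normr0; rewrite big1.
have [B BL|] := IH; first by apply: h; rewrite in_cons BL orbT.
have -> : approx_seq (A :: L) = approx A ++ approx_seq L by [].
have [sA nA] := h A (mem_head _ _).
have n1 a : 5/6 <= A a a by apply: le_trans (nA a); lra.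
have n2 a : 2/3 <= A a a by apply: le_trans (n1 a); lra.
have [a1 a2 a3] := approxP sA n2; have /andP[a4 a5] := det_defect sA n1.
move: a1 a2 a3; move: (approx A) => ap a1 a2 a3.
rewrite !big_cons big_cat /=.
move: a2 a3; set B := \prod_(_ <- ap) _ => a2 a3.
set P := \prod_(_ <- L) _; set Q := \prod_(_ <- approx_seq L) _.
set d2 := \sum_(_ <- L) 4 * _; set d1 := \sum_(_ <- L) _ => h1 h2 [h3 h4 h5] h6 h7.
have df0 : 0 <= defect A.
  have le1 a : A a a <= 1 by case: sA => A0 A1; rewrite -(A1 a) (bigD1 a) //= lerDl sumr_ge0.
  by rewrite /defect; have := le1 o0; have := le1 o1; have := le1 o2; lra.
have df1 : defect A <= 1/2.
  by rewrite /defect; have := n1 o0; have := n1 o1; have := n1 o2; lra.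
have sQ : row_stochastic Q by apply: stochastic_prod => x /h1; exact: stochastic_elementary.
have el x : x \in ap ++ approx_seq L -> is_elementary x.
  by rewrite mem_cat => /orP[/a1|/h1].
rewrite -!mulmxE !det_mulmx; split=> //.
- have -> : A *m P - B *m Q = (A - B) *m Q + A *m (P - Q).
    by rewrite mulmxBl mulmxBr [RHS]addrC addrA subrK.
  have r1 := row_normM ler01 a2 (row_norm_stochastic sQ).
  have d20 : 0 <= d2.
    by rewrite /d2; apply: sumr_ge0 => x _; rewrite mulr_ge0 // sqr_ge0.
  have r2 := row_normM d20 (row_norm_stochastic sA) h2.
  by have := row_normD r1 r2; rewrite mulr1 mul1r.
- by split; [exact: stochasticM | rewrite addr_ge0 | rewrite mulr_gt0].
- apply: le_trans h6.
  have -> : \det A * \det P * (1 + (defect A + d1) / 2)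
    = \det P * (\det A * (1 + (defect A + d1) / 2)) by ring.
  rewrite ler_pM2l //.
  apply: (@le_trans _ _ ((1 - defect A / 2) * (1 + (defect A + d1) / 2))).
    by rewrite ler_wpM2r // addr_ge0 // divr_ge0 // addr_ge0.
  by have := sqr_ge0 (defect A); have := mulr_ge0 df0 h4; lra.
- rewrite exprMn ler_pM ?exprn_ge0 ?(ltW a4) ?(ltW h5) //.
  apply: le_trans a3.
  apply: (@le_trans _ _ ((1 - defect A / 2) ^+ 4)).
    by rewrite lerXn2r ?nnegrE ?(ltW a4) //; lra.
  move: (defect A) df0 df1 => x x0 x1.
  have -> : (1 - x / 2) ^+ 4 = 1 - 2 * x + x * x * (3/2 - x / 2) + x * x * x * x / 16 by field.
  have xx : x * x <= x / 2 by have := ler_wpM2l x0 x1; lra.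
  have b1 : x * x * (3/2 - x / 2) <= x / 2 * (3 / 2).
    by apply: ler_pM => //; rewrite ?mulr_ge0 //; lra.
  have b2 : x * x * x * x <= x / 2 * 1.
    rewrite -mulrA; apply: ler_pM; rewrite ?mulr_ge0 //.
    by rewrite mulr_ile1 //; lra.
  lra.
Qed.

Lemma near_identity_le e e' A : e <= e' -> near_identity e A -> near_identity e' A.
Proof. by move=> ee [sA nA]; split=> // a; apply: le_trans (nA a); lra. Qed.

Lemma defect_le e A : near_identity e A -> defect A <= 3 * e.
Proof. by move=> [_ nA]; rewrite /defect; have := nA o0; have := nA o1; have := nA o2; lra. Qed.

Lemma process_local (P : R -> R -> 'M[R]_3) c e : markov_process P -> 0 <= c -> 0 < e ->
  exists2 d, 0 < d &
  forall s t, 0 <= s <= t -> `|s - c| < d -> `|t - c| < d -> near_identity e (P s t).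
Proof.
move=> hP c0 e0; have /subspace_continuousP/(_ (c, c)) := markov_continuous hP.
have Dc : time_domain (c, c) by rewrite /time_domain /= c0 lexx.
move=> /(_ Dc) /= cv.
have H a : \forall st \near within (@time_domain R) (nbhs (c, c)), `|1 - P st.1 st.2 a a| < e.
  have cva : P st.1 st.2 a a @[st --> within (@time_domain R) (nbhs (c, c))] --> P c c a a.
    by apply: cvg_comp cv (@coord_continuous R 3 3 a a (P c c)).
  move: cva; rewrite (markov_id hP) // mxE eqxx => /cvgrPdist_lt; apply; exact: e0.
have : \forall st \near within (@time_domain R) (nbhs (c, c)), forall a,
  `|1 - P st.1 st.2 a a| < e.
  near=> st; suff : forall a, `|1 - P st.1 st.2 a a| < e by [].
  by apply: (frame_ind F012); near: st; apply: H.
move/nbhs_ballP => [d /= d0 hd]; exists d => // s t st sc tc; split;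
  first exact: (markov_stochastic hP).
move=> a; have B : ball (c, c) d (s, t) by split; rewrite /ball /= distrC.
by have := hd (s, t) B st a; rewrite /= ltr_norml => /andP[_ h]; lra.
Unshelve. all: by end_near.
Qed.

Definition chain (P : R -> R -> 'M[R]_3) e t := exists L : seq 'M[R]_3, (forall A,
  A \in L -> near_identity e A) /\ P 0 t = \prod_(A <- L) A.

(** Supremum argument: a decomposition of P(0, t) for t close to the supremum extends past it by
    one factor that process_local makes near the identity. *)
Lemma chain1 (P : R -> R -> 'M[R]_3) e : markov_process P -> 0 < e -> chain P e 1.
Proof.
move=> hP e0; pose E := [set t : R | 0 <= t <= 1 /\ chain P e t].
have E0 : E 0.
  split; first by rewrite lexx ler01.
  by exists [::]; rewrite big_nil (markov_id hP).
have hs : has_sup E by split; [exists 0 | exists 1 => t [/andP[]]].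
have c0 : 0 <= sup E by apply: ub_le_sup => //; case: hs.
have c1 : sup E <= 1 by apply: ge_sup => // [|t [/andP[]]]; [exists 0|].
have [d d0 hd] := process_local hP c0 e0.
have [t [/andP[t0 t1] [L [hL PL]]] tc] := sup_adherent d0 hs.
have tle : t <= sup E by apply: ub_le_sup; [case: hs | split=> //; [rewrite t0|exists L]].
pose t' := Num.min 1 (sup E + d / 2).
have tt' : t <= t' by rewrite /t' le_min t1 /=; lra.
have t'1 : t' <= 1 by rewrite /t' ge_min lexx.
have t'c : t' <= sup E + d / 2 by rewrite /t' ge_min lexx orbT.
have Et' : E t'.
  split; first by rewrite t'1 (le_trans t0 tt').
  exists (rcons L (P t t')); split.
    move=> A; rewrite mem_rcons in_cons => /orP[/eqP->|/hL//].
    apply: hd; first by rewrite t0.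
      by rewrite ltr_norml; apply/andP; split; lra.
    have : sup E - d < t' by apply: lt_le_trans tc tt'.
    by rewrite ltr_norml => ?; apply/andP; split; lra.
  by rewrite -cats1 big_cat big_seq1 /= -mulmxE -PL (markov_comp hP).
have t'le : t' <= sup E by apply: ub_le_sup => //; case: hs.
have -> : 1 = t'; last by case: Et'.
move: t'le; rewrite /t'; case: (lerP 1 (sup E + d / 2)) => // _ h; exfalso; lra.
Qed.

Lemma process_seven (P : R -> R -> 'M[R]_3) : markov_process P ->
  exists s : seq 'M[R]_3, [/\ size s = 7,
  forall A, A \in s -> is_elementary A & P 0 1 = \prod_(A <- s) A].
Proof.
move=> hP; have p6 : 0 < 1/6 :> R by lra.
have dl0 : 0 < \det (P 0 1).
  by have [L [hL ->]] := chain1 hP p6; have [_ _ [_ _ h] _ _] := approx_seqP hL.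
set dl := \det _ in dl0.
apply: (closure_seven (exprn_gt0 4 dl0)) => e e0.
(* the error is at most 4 * 3 e' times the sum of the defects, which is at most 2 / dl *)
pose e' := Num.min (1/6) (e * dl / 24).
have e'0 : 0 < e' by rewrite lt_min p6 divr_gt0 // mulr_gt0.
have e'1 : e' <= 1/6 by rewrite ge_min lexx.
have e'2 : e' <= e * dl / 24 by rewrite ge_min lexx orbT.
have [L [hL PL]] := chain1 hP e'0.
have hL6 A : A \in L -> near_identity (1/6) A by move=> /hL; exact: near_identity_le.
have [h1 h2 [h3 h4 h5] h6 h7] := approx_seqP hL6.
exists (approx_seq L); split=> //; first by rewrite /dl PL.
move=> a b; have := h2 a; rewrite -PL in h2 h6 *.
have sb : `|P 0 1 a b - (\prod_(B <- approx_seq L) B) a b|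
  <= \sum_c `|(P 0 1 - \prod_(B <- approx_seq L) B) a c|.
  rewrite (bigD1 b) //=; apply: ler_wpDr; first by rewrite sumr_ge0.
  by rewrite !mxE.
move=> h; apply: le_trans sb (le_trans h _).
set D := \sum_(A <- L) defect A in h4 h6.
have le1 : \sum_(A <- L) 4 * defect A ^+ 2 <= 12 * e' * D.
  rewrite /D mulr_sumr big_seq [leRHS]big_seq; apply: ler_sum => A AL.
  have [[A0 A1] nA] := hL _ AL; have df := defect_le (hL _ AL).
  have df0 : 0 <= defect A.
    have l1 x : A x x <= 1 by rewrite -(A1 x) (bigD1 x) //= lerDl sumr_ge0.
    by rewrite /defect; have := l1 o0; have := l1 o1; have := l1 o2; lra.
  rewrite expr2; have := ler_wpM2r df0 df; lra.
apply: (le_trans le1).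
have Dd : dl * D <= 2 by move: h6; rewrite -/dl; lra.
have e24 : 12 * e' * D <= e * (dl * D) / 2.
  by have := ler_wpM2r h4 e'2; lra.
by apply: (le_trans e24); have := ler_wpM2l (ltW e0) Dd; lra.
Qed.

End Process.

Theorem theorem1p1 (R : realType) (P : 'M[R]_3) (hP : row_stochastic P)
    (hatt : attainable P) :
  exists s : seq 'M[R]_3,
    [/\ (size s <= 7)%N,
        (forall A, A \in s -> is_elementary A) &
        P = \prod_(A <- s) A].
Proof.
have [_ [F [mF ->]]] := hatt; have [s [s7 hs E]] := process_seven mF.
by exists s; rewrite s7.
Qed.
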